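(* Let $\mu$ be a partition of $m$ and let $\nu$ be a partition of $n$. Let $\eta=\mu'$. The partitions $\lambda$ of $mn$ that are maximal in the dominance order among those for which the Specht module $S^\lambda$ is a summand of $H_\mu^\nu$ are precisely the partitions that are maximal in the dominance order among the partitions occurring as weights of conjugate-semistandard tableau family tuples of shape $\eta^{\nu'}$.
   Context: Here $m,n$ are positive integers and $\mathbb{N}=\{1,2,\ldots\}$. For a partition $\gamma$, $\gamma'$ denotes its conjugate. $S^\lambda$ is the Specht module over $\mathbb{Q}$ for the symmetric group, labelled by $\lambda$ (irreducible, with $S^{(r)}$ the trivial $\mathbb{Q}S_r$-module). The wreath product $S_m\wr S_n$ acts as a transitive imprimitive subgroup of $S_{mn}$. For a $\mathbb{Q}S_m$-module $W$ and a $\mathbb{Q}S_n$-module $Z$, $W\oslash Z$ is the $\mathbb{Q}(S_m\wr S_n)$-module $W^{\otimes n}\otimes Z$, where $S_m^n$ acts factorwise on $W^{\otimes n}$ and trivially on $Z$, and $S_n$ acts by permuting the tensor factors of $W^{\otimes n}$ (no signs) and by its given action on $Z$. The generalized Foulkes module is $H_\mu^\nu=(S^\mu\oslash S^\nu)\uparrow_{S_m\wr S_n}^{S_{mn}}$. A tableau with entries in $\mathbb{N}$ is conjugate-semistandard if its rows are strictly increasing (left to right) and its columns are weakly increasing (top to bottom). For a partition $\alpha$ and $d\in\mathbb{N}$, a conjugate-semistandard tableau family of shape $\alpha^d$ is a set of $d$ (distinct) conjugate-semistandard $\alpha$-tableaux. If $\beta$ is a partition with exactly $c$ parts, a conjugate-semistandard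 tableau family tuple of shape $\alpha^\beta$ is a tuple $(\mathcal{T}_1,\ldots,\mathcal{T}_c)$ where each $\mathcal{T}_i$ is a conjugate-semistandard tableau family of shape $\alpha^{\beta_i}$. Its weight is the composition $(\gamma_1,\ldots,\gamma_M)$, where $M$ is the greatest entry of the tableaux in $\mathcal{T}_1,\ldots,\mathcal{T}_c$ and $\gamma_j$ is the total number of occurrences of $j$ in the tableaux in the families $\mathcal{T}_1,\ldots,\mathcal{T}_c$. *)

(* Defs.v *)
From HB Require Import structures.
From mathcomp Require Import all_boot all_order all_algebra all_fingroup.
From mathcomp Require Import mxrepresentation character finmap.

Set Implicit Arguments.
Unset Strict Implicit.
Unset Printing Implicit Defensive.

Import GroupScope GRing.Theory.
Local Open Scope ring_scope.

(* Partitions are their sequences of (positive, weakly decreasing) parts. *)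

Definition is_part (ga : seq nat) : bool := sorted geq ga && (0%N \notin ga).

Definition is_part_of (r : nat) (ga : seq nat) : bool :=
  is_part ga && (sumn ga == r).

Definition conj_part (ga : seq nat) : seq nat :=
  [seq count (fun part => j < part)%N ga | j <- iota 0 (head 0%N ga)].

Definition dominates (la ka : seq nat) : Prop :=
  forall k : nat, (sumn (take k ka) <= sumn (take k la))%N.

Definition dom_maximal (P : seq nat -> Prop) (la : seq nat) : Prop :=
  P la /\ (forall ka, P ka -> dominates ka la -> ka = la).

(* A tableau is the sequence of its rows, from top to bottom. *)

Definition tableau : Type := seq (seq nat).

Definition conj_semistandard (al : seq nat) (t : tableau) : bool :=
  [&& shape t == al,
      all (all (fun x => 0 < x)%N) t,
      all (sorted ltn) t &
      sorted (fun row1 row2 : seq nat =>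
                all (fun j => nth 0 row1 j <= nth 0 row2 j)%N
                    (iota 0 (size row2))) t].

Definition css_family (al : seq nat) (d : nat) (T : {fset tableau}) : bool :=
  (#|` T|%fset == d) && all (conj_semistandard al) T.

Definition css_family_tuple (al be : seq nat) (Ts : seq {fset tableau}) : bool :=
  all2 (fun T d => css_family al d T) Ts be.

Definition occurrences (Ts : seq {fset tableau}) (j : nat) : nat :=
  (\sum_(T <- Ts) \sum_(t <- T) count_mem j (flatten t))%N.

Definition greatest_entry (Ts : seq {fset tableau}) : nat :=
  (\max_(T <- Ts) \max_(t <- T) \max_(x <- flatten t) x)%N.

Definition weight (Ts : seq {fset tableau}) : seq nat :=
  [seq occurrences Ts j | j <- iota 1 (greatest_entry Ts)].

Section FinTypeMatrix.

Variables (F : fieldType) (T : finType).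

Definition fmx (M : T -> T -> F) : 'M[F]_#|T| :=
  \matrix_(i, j) M (enum_val i) (enum_val j).

Lemma fmx1 (M : T -> T -> F) :
  (forall x y, M x y = (x == y)%:R) -> fmx M = 1%:M.
Proof.
by move=> M1; apply/matrixP=> i j; rewrite !mxE M1 (inj_eq enum_val_inj).
Qed.

Lemma fmxM (M N L : T -> T -> F) :
  (forall x y, L x y = \sum_z M x z * N z y) -> fmx L = fmx M *m fmx N.
Proof.
move=> LE; apply/matrixP=> i j; rewrite !mxE LE.
rewrite (reindex (fun k : 'I_#|T| => enum_val k)) /=; last first.
  exact: onW_bij (enum_val_bij T).
by apply: eq_bigr => k _; rewrite !mxE.
Qed.

Lemma mul_row_fmx (v : T -> F) (M : T -> T -> F) :
  (\row_i v (enum_val i)) *m fmx M = \row_j \sum_x v x * M x (enum_val j).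
Proof.
apply/rowP=> j; rewrite !mxE.
rewrite [RHS](reindex (fun k : 'I_#|T| => enum_val k)) /=; last first.
  exact: onW_bij (enum_val_bij T).
by apply: eq_bigr => k _; rewrite !mxE.
Qed.

End FinTypeMatrix.


Section InducedModule.

Variables (F : fieldType) (gT : finGroupType) (G H : {group gT}).
Variables (sHG : H \subset G) (rH : representation F H).

(* Basis of V (x)_FH FG: the v_a (x) repr C, where (v_a) is the standard basis
   of V and C runs over the right cosets H\G; v_a (x) repr C is sent by x to
   v_a h (x) repr D, where repr C * x = h * repr D with h in H. *)
Definition coset_basis : finType :=
  ({C : {set gT} | C \in rcosets H G} * 'I_(rdegree rH))%type.

Definition induced_coef (x : gT) (Ca Db : coset_basis) : F :=
  let h := (repr (val Ca.1) * x * (repr (val Db.1))^-1)%g in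
  if h \in H then rH h Ca.2 Db.2 else 0.

Fact induced_mx_repr : mx_repr G (fun x => fmx (induced_coef x)).
Proof.
have reprG (C : {C : {set gT} | C \in rcosets H G}) :
    (repr (val C) \in G) /\ val C = H :* repr (val C).
  case: C => C /= /rcosetsP[x Gx ->]; split; last by rewrite rcoset_repr.
  have /rcosetP[h Hh ->] := mem_repr_rcoset H x.
  by rewrite groupM // (subsetP sHG).
split=> [|x y Gx Gy].
  apply: fmx1 => -[C a] [D b]; rewrite /induced_coef /= mulg1 -mem_rcoset.
  rewrite xpair_eqE -val_eqE /=.
  have [_ eC] := reprG C; have [_ eD] := reprG D.
  have -> : (repr (val C) \in H :* repr (val D)) = (val C == val D).
    by apply/rcoset_eqP/eqP; rewrite -eC -eD.
  case: eqP => [->|//]; by rewrite mulgV repr_mx1 mxE.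
apply: fmxM => -[C a] [D b].
transitivity (\sum_E \sum_c
    induced_coef x (C, a) (E, c) * induced_coef y (E, c) (D, b)); last first.
  by rewrite pair_bigA; apply: eq_bigr => -[].
rewrite /induced_coef /=.
have [GC eC] := reprG C; have [GD eD] := reprG D.
have EP : H :* (repr (val C) * x) \in rcosets H G.
  by apply/rcosetsP; exists (repr (val C) * x)%g; rewrite // groupM.
pose E : {C : {set gT} | C \in rcosets H G} := exist (fun A => A \in rcosets H G) _ EP.
have [GE eE] := reprG E.
have HE : (repr (val C) * x * (repr (val E))^-1)%g \in H.
  by rewrite -mem_rcoset -eE /= rcoset_refl.
rewrite (bigD1 E) //= [X in _ + X]big1 ?addr0.
  have -> : (repr (val C) * (x * y) * (repr (val D))^-1 =
    (repr (val C) * x * (repr (val E))^-1) *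
    (repr (val E) * y * (repr (val D))^-1))%g by rewrite !mulgA mulgKV.
  under eq_bigr do rewrite HE.
  rewrite groupMl //; case: ifP => [HD|_]; last by rewrite big1 // => c _; rewrite mulr0.
  by rewrite repr_mxM // mxE.
move=> E' neE'; apply: big1 => c _; case: ifP; last by rewrite mul0r.
have [_ eE'] := reprG E'.
rewrite -mem_rcoset => /rcoset_eqP CE'; case/eqP: neE'.
by apply: val_inj; rewrite /= CE' -eE'.
Qed.

Definition induced_repr : representation F G :=
  Representation (MxRepresentation induced_mx_repr).

End InducedModule.

Definition is_summand (F : fieldType) (gT : finGroupType) (G : {group gT})
    (rU rV : representation F G) : Prop :=
  exists rW : representation F G, mx_rsim rV (dadd_grepr rU rW).

(* The letters of S_(mn) are the cells (x, k) = mxvec_index x k of an m x n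
   array; S_m wr S_n is the stabiliser of the system of n blocks of size m
   formed by its columns. An element s of it sends (x, k) to
   (wr_base s k x, wr_top s k). *)

Section WreathProduct.

Variables m n : nat.

Definition cell (i : 'I_(m * n)) : 'I_m * 'I_n :=
  enum_val (cast_ord (esym (mxvec_cast m n)) i).
Definition pos i := (cell i).1.
Definition blk i := (cell i).2.

Lemma mxvec_indexK x k : cell (mxvec_index x k) = (x, k).
Proof. by rewrite /cell /mxvec_index cast_ordK enum_rankK. Qed.

Lemma posE x k : pos (mxvec_index x k) = x.
Proof. by rewrite /pos mxvec_indexK. Qed.

Lemma blkE x k : blk (mxvec_index x k) = k.
Proof. by rewrite /blk mxvec_indexK. Qed.

Lemma cellK i : mxvec_index (pos i) (blk i) = i.
Proof. by case/mxvec_indexP: i => x k; rewrite posE blkE. Qed.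

Definition wreath : {set 'S_(m * n)} :=
  [set s : 'S_(m * n) |
     [forall i, forall j, (blk i == blk j) ==> (blk (s i) == blk (s j))]].

Lemma wreathP (s : 'S_(m * n)) :
  reflect (forall i j, blk i = blk j -> blk (s i) = blk (s j)) (s \in wreath).
Proof.
rewrite inE; apply: (iffP forallP) => [H i j /eqP ij|H i].
  by apply/eqP; apply: (implyP (forallP (H i) j)).
by apply/forallP=> j; apply/implyP=> /eqP ij; apply/eqP/H.
Qed.

Fact wreath_group_set : group_set wreath.
Proof.
apply/group_setP; split=> [|s t /wreathP Hs /wreathP Ht].
  by apply/wreathP=> i j; rewrite !perm1.
by apply/wreathP=> i j ij; rewrite !permM; apply/Ht/Hs.
Qed.
Canonical wreath_group := Group wreath_group_set.

Definition wr_top (s : 'S_(m * n)) : 'S_n :=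
  insubd (1%g : 'S_n) [ffun k => if [pick x : 'I_m] is Some x
                        then blk (s (mxvec_index x k)) else k].

Definition wr_base (s : 'S_(m * n)) (k : 'I_n) : 'S_m :=
  insubd (1%g : 'S_m) [ffun x => pos (s (mxvec_index x k))].

Lemma insubd_permE (T : finType) (f : {ffun T -> T}) x :
  injective f -> insubd (1%g : {perm T}) f x = f x.
Proof. by move=> /injectiveP fI; rewrite -pvalE insubdK. Qed.

Lemma wr_topE s i : s \in wreath -> blk (s i) = wr_top s (blk i).
Proof.
move=> /wreathP Hs; rewrite /wr_top; case: pickP => [x _|/(_ (pos i)) //].
rewrite insubd_permE ?ffunE; first by apply: Hs; rewrite blkE.
set f := finfun _; pose g k := blk ((s^-1)%g (mxvec_index x k)).
have fK : cancel g f.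
  move=> k; rewrite ffunE /g -[RHS](blkE x) -[in RHS](permKV s (mxvec_index x k)).
  by apply: Hs; rewrite blkE.
exact/(can_inj (canF_sym fK)).
Qed.

Lemma wr_baseE s i : s \in wreath -> pos (s i) = wr_base s (blk i) (pos i).
Proof.
move=> /wreathP Hs; rewrite /wr_base insubd_permE ?ffunE ?cellK // => x y.
rewrite !ffunE => pE.
have bE : blk (s (mxvec_index x (blk i))) = blk (s (mxvec_index y (blk i))).
  by apply: Hs; rewrite !blkE.
have /perm_inj e : s (mxvec_index x (blk i)) = s (mxvec_index y (blk i)).
  by rewrite -[LHS]cellK -[RHS]cellK pE bE.
by rewrite -[x](posE x (blk i)) e posE.
Qed.

Lemma wr_top1 : wr_top 1%g = 1%g.
Proof.
apply/permP=> k; rewrite /wr_top perm1.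
case: pickP => [x _|_]; last by rewrite insubd_permE ?ffunE // => ? ?; rewrite !ffunE.
rewrite insubd_permE ?ffunE ?perm1 ?blkE // => ? ?.
by rewrite !ffunE !perm1 !blkE.
Qed.

Lemma wr_topM : {in wreath &, {morph wr_top : s t / (s * t)%g}}.
Proof.
move=> s t Ws Wt; apply/permP=> k; rewrite permM.
case: (pickP (fun x : 'I_m => true)) => [x _|m0]; last first.
  have wr_id u : wr_top u = 1%g.
    apply/permP=> j; rewrite /wr_top; case: pickP => [x _|_]; first by have := m0 x.
    by rewrite insubd_permE ?ffunE ?perm1 // => ? ?; rewrite !ffunE.
  by rewrite !wr_id !perm1.
by rewrite -[k](blkE x) -!wr_topE ?groupM // permM.
Qed.

Lemma wr_base1 k : wr_base 1%g k = 1%g.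
Proof.
apply/permP=> x; have := wr_baseE (mxvec_index x k) (group1 wreath_group).
by rewrite !perm1 blkE posE.
Qed.

Lemma wr_baseM s t k : s \in wreath -> t \in wreath ->
  wr_base (s * t)%g k = (wr_base s k * wr_base t (wr_top s k))%g.
Proof.
move=> Ws Wt; apply/permP=> x; rewrite permM.
have := wr_baseE (mxvec_index x k) (groupM Ws Wt).
rewrite permM blkE posE => <-.
by rewrite wr_baseE // wr_topE // wr_baseE // blkE posE.
Qed.

(* The basis element (f, b) of W^(x)n (x) Z is w_(f 0) (x) ... (x) w_(f (n-1))
   (x) z_b. The k-th factor w of a tensor is sent by s to its image under
   wr_base s k, placed in position wr_top s k. *)

Variables (F : fieldType).
Variables (rW : representation F [set: 'S_m]) (rZ : representation F [set: 'S_n]).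

Definition oslash_basis : finType :=
  ({ffun 'I_n -> 'I_(rdegree rW)} * 'I_(rdegree rZ))%type.

Definition oslash_coef (s : 'S_(m * n)) (fa gb : oslash_basis) : F :=
  (\prod_k rW (wr_base s k) (fa.1 k) (gb.1 (wr_top s k)))
    * rZ (wr_top s) fa.2 gb.2.

Fact oslash_mx_repr : mx_repr wreath (fun s => fmx (oslash_coef s)).
Proof.
split=> [|s t Ws Wt].
  apply: fmx1 => -[f a] [g b]; rewrite /oslash_coef /= wr_top1 repr_mx1 mxE.
  under eq_bigr do rewrite wr_base1 perm1 repr_mx1 mxE.
  rewrite xpair_eqE; have [->|neq_fg] /= := eqVneq f g.
    by rewrite big1 ?mul1r // => k _; rewrite eqxx.
  have [k /negPf fgk] : exists k, f k != g k.
    apply/existsP; apply: contraR neq_fg; rewrite negb_exists => /forallP fg.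
    by apply/eqP/ffunP=> k; apply/eqP; have := fg k; rewrite negbK.
  by rewrite (bigD1 k) //= fgk !mul0r.
apply: fmxM => -[f a] [g b].
transitivity (\sum_h \sum_c
    oslash_coef s (f, a) (h, c) * oslash_coef t (h, c) (g, b)); last first.
  by rewrite pair_bigA; apply: eq_bigr => -[].
rewrite /oslash_coef /=.
under [RHS]eq_bigr => h _ do
  [under eq_bigr do rewrite mulrACA; rewrite -mulr_sumr].
rewrite -mulr_suml wr_topM // repr_mxM ?inE // mxE; congr (_ * _).
under eq_bigr do rewrite wr_baseM // repr_mxM ?inE // mxE.
rewrite bigA_distr_bigA /=.
pose T := wr_top s.
rewrite (reindex (fun h : {ffun 'I_n -> 'I_(rdegree rW)} => [ffun k => h (T k)])).
  apply: eq_bigr => h _.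
  rewrite [X in _ = _ * X](reindex_inj (@perm_inj _ T)) -big_split /=.
  by apply: eq_bigr => k _; rewrite ffunE permM.
exists (fun h : {ffun 'I_n -> 'I_(rdegree rW)} => [ffun k => h ((T^-1)%g k)]).
  by move=> h _; apply/ffunP=> k; rewrite !ffunE permKV.
by move=> h _; apply/ffunP=> k; rewrite !ffunE permK.
Qed.

Definition oslash : representation F wreath :=
  Representation (MxRepresentation oslash_mx_repr).

End WreathProduct.

(* A la-tableau is a permutation t : 'S_r, whose entry in the i-th box of the
   diagram of la, in row by row reading order, is t i. Tabloids are classes of
   row-equivalent tableaux. Products of permutations compose from left to right,
   so t * g is t with g applied to its entries, and matrices act on row vectors
   from the right. *)

Section SpechtModule.

Variables (r : nat) (la : seq nat).

Definition row_of (t : 'S_r) (x : 'I_r) : nat := reshape_index la ((t^-1)%g x).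
Definition col_of (t : 'S_r) (x : 'I_r) : nat := reshape_offset la ((t^-1)%g x).

Definition tabloid (t : 'S_r) : {set 'S_r} :=
  [set u : 'S_r | [forall x, row_of u x == row_of t x]].

Definition col_stab (t : 'S_r) : {set 'S_r} :=
  [set q : 'S_r | [forall x : 'I_r, col_of t (q x) == col_of t x]].

Definition tabloids : finType :=
  {X : {set 'S_r} | X \in [set tabloid t | t : 'S_r]}.

Lemma tabloid_act t (g : 'S_r) : tabloid t :* g = tabloid (t * g)%g.
Proof.
apply/setP=> u; rewrite mem_rcoset !inE; apply/forallP/forallP => H x.
  by have := H ((g^-1)%g x); rewrite /row_of !invMg invgK !permM permKV.
by have := H (g x); rewrite /row_of !invMg invgK !permM permK.
Qed.

Definition tabloid_coef (g : 'S_r) (X Y : tabloids) : rat :=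
  (val X :* g == val Y)%:R.

Fact tabloid_mx_repr : mx_repr [set: 'S_r] (fun g => fmx (tabloid_coef g)).
Proof.
split=> [|g h _ _]; first by apply: fmx1 => X Y; rewrite /tabloid_coef rcoset1.
apply: fmxM => X Y; rewrite /tabloid_coef.
have XP : val X :* g \in [set tabloid t | t : 'S_r].
  by case/imsetP: (valP X) => t _ ->; rewrite tabloid_act imset_f.
pose Xg : tabloids := exist (fun A => A \in [set tabloid t | t : 'S_r]) _ XP.
rewrite (bigD1 Xg) //= eqxx mul1r rcosetM big1 ?addr0 // => Z neZ.
by case: eqP => [e|]; rewrite ?mul0r //; case/eqP: neZ; apply: val_inj.
Qed.

Definition tabloid_repr : mx_representation rat [set: 'S_r] #|tabloids| :=
  MxRepresentation tabloid_mx_repr.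

Definition polytabloid (t : 'S_r) : 'rV[rat]_#|tabloids| :=
  \row_i \sum_(q in col_stab t)
     (-1) ^+ (q : bool) * (tabloid t :* q == val (enum_val i))%:R.

Definition specht_mx : 'M[rat]_#|tabloids| := (\sum_t <<polytabloid t>>)%MS.

Lemma polytabloid_act t g :
  polytabloid t *m tabloid_repr g = polytabloid (t * g)%g.
Proof.
rewrite [LHS](mul_row_fmx (fun X => \sum_(q in col_stab t)
  (-1) ^+ (q : bool) * (tabloid t :* q == val X)%:R)).
apply/rowP=> j; rewrite !mxE; set Y := enum_val j.
under eq_bigr do rewrite mulr_suml.
rewrite exchange_big /= [RHS](reindex_inj (conjg_inj g)) /=.
apply: eq_big => [q|q _].
  rewrite !inE; apply/forallP/forallP => H x.
    have := H ((g^-1)%g x).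
    by rewrite /col_of conjgE !invMg !permM permK.
  have := H (g x).
  by rewrite /col_of conjgE !invMg !permM !permK.
have XP : tabloid t :* q \in [set tabloid t | t : 'S_r].
  by rewrite tabloid_act imset_f.
pose X : tabloids := exist (fun A => A \in [set tabloid t | t : 'S_r]) _ XP.
rewrite (bigD1 X) //= eqxx mulr1 big1 ?addr0.
  rewrite odd_permJ /tabloid_coef /= -!rcosetM.
  by rewrite -tabloid_act -rcosetM conjgC.
move=> Z neZ; case: eqP => [e|]; last by rewrite mulr0 mul0r.
by case/eqP: neZ; apply: val_inj.
Qed.

Fact specht_module : mxmodule tabloid_repr specht_mx.
Proof.
apply/mxmoduleP=> g _; rewrite sumsmxMr; apply/sumsmx_subP=> t _.
rewrite (eqmxMr _ (genmxE _)) polytabloid_act.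
by apply: (sumsmx_sup (t * g)%g); rewrite ?genmxE.
Qed.

Definition specht : representation rat [set: 'S_r] :=
  Representation (submod_repr specht_module).

End SpechtModule.

Definition foulkes (m n : nat) (mu nu : seq nat) :
    representation rat [set: 'S_(m * n)] :=
  induced_repr (subsetT (wreath_group m n)) (oslash (specht m mu) (specht n nu)).

(* Main.v *)
(* A word of content la on the mn letters is a tabloid of shape la, and the
   nonzero homomorphisms from the Foulkes module to the permutation module M^la
   control its dominance-maximal constituents: if S^la is a summand there is
   such a homomorphism, and conversely a nonzero homomorphism to M^la yields a
   summand S^ka with ka dominating la, since Specht modules exhaust the
   irreducible modules and Hom(S^ka, M^la) <> 0 forces ka to dominate la.

   By Frobenius reciprocity one studies homomorphisms from the wreath product
   module, which is generated by the tensor product of polytabloids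
   e (x) ... (x) e (x) e'. The image f of this generator is a function on words.
   A word in the support of f that maximises two successive potentials restricts
   to a semistandard mu-tableau on each block, by the Garnir relations, and
   blocks in the same column of nu carry distinct tableaux, because f changes
   sign under the column stabiliser of nu. These data are exactly a tableau
   family tuple of shape (mu')^(nu') and weight la. Conversely, given such a
   tuple one may permute the blocks so that, after labelling the tableaux by
   integers, they form a semistandard nu-tableau; then the average over the
   wreath product of a rank-one map is nonzero, as all terms of the relevant
   coefficient are nonnegative. *)

Require Import Defs.
From HB Require Import structures.
From mathcomp Require Import all_boot all_order all_algebra all_fingroup.
From mathcomp Require Import mxrepresentation character finmap zify lra.

Set Implicit Arguments.
Unset Strict Implicit.
Unset Printing Implicit Defensive.

(** * Cells of a partition *)

(* Cells of the diagram of mu are numbered row by row from 0; rowc and colc are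
   the coordinates of the cell x, and collen mu j is the length of column j. *)
Definition rowc (mu : seq nat) (x : nat) : nat := reshape_index mu x.
Definition colc (mu : seq nat) (x : nat) : nat := reshape_offset mu x.
Definition collen (mu : seq nat) (j : nat) : nat := count (fun a => j < a) mu.

Lemma part_nth_le mu i j : is_part mu -> i <= j -> nth 0 mu j <= nth 0 mu i.
Proof.
move=> /andP[smu _] ij; case: (ltnP j (size mu)) => [jlt|]; last by move/(nth_default 0)->.
have geqT : transitive geq by move=> a b c /= ab bc; apply: leq_trans bc ab.
by apply: (sorted_leq_nth geqT leqnn) => //; rewrite inE // (leq_ltn_trans ij).
Qed.

Lemma part_nth_gt0 mu i : is_part mu -> (0 < nth 0 mu i) = (i < size mu).
Proof.
move=> /andP[_ mu0]; case: (ltnP i (size mu)) => [ilt|ige]; last by rewrite nth_default.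
by rewrite lt0n; apply: contraNneq mu0 => <-; apply: mem_nth.
Qed.

(** Both sides say that the box in row [i] and column [j] lies in the diagram. *)
Lemma ltn_collen mu i j : is_part mu -> (i < collen mu j) = (j < nth 0 mu i).
Proof.
rewrite /collen; elim: mu i => [|a mu IH] i pmu; first by rewrite /= nth_nil.
have pmu' : is_part mu.
  by case/andP: pmu => /path_sorted smu; rewrite inE negb_or => /andP[_ n0]; apply/andP.
rewrite /=; case: (ltnP j a) => [ja|aj]; last first.
  rewrite add0n [LHS]IH //; case: i => [|i] /=.
    by have := @part_nth_le _ 0 1 pmu isT; rewrite /=; case: mu {IH pmu pmu'} => [|b mu] /=; lia.
  have := @part_nth_le _ 0 i.+2 pmu isT; have := @part_nth_le _ 0 i.+1 pmu isT.
  by rewrite /=; lia.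
by case: i => [|i] /=; rewrite ?ja // add1n ltnS IH.
Qed.

Section Cells.

Variables (m : nat) (mu : seq nat).
Hypothesis mu_m : is_part_of m mu.
Implicit Types x y : 'I_m.

Let pmu : is_part mu. Proof. by case/andP: mu_m. Qed.
Let smu : sumn mu = m. Proof. by case/andP: mu_m => _ /eqP. Qed.

Lemma colc_lt x : colc mu x < nth 0 mu (rowc mu x).
Proof. by rewrite reshape_offsetP // smu. Qed.

Lemma cell_inj x y : rowc mu x = rowc mu y -> colc mu x = colc mu y -> x = y.
Proof.
move=> er ec; apply: val_inj; rewrite /= -[val x](reshape_indexK mu).
by rewrite -[val y](reshape_indexK mu) -/(rowc _ _) -/(colc _ _) er ec.
Qed.

Lemma cell_exists i j : j < nth 0 mu i -> exists2 x : 'I_m, rowc mu x = i & colc mu x = j.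
Proof.
move=> jlt; have lt_m : flatten_index mu i j < m.
  by rewrite -smu flatten_indexP.
by exists (Ordinal lt_m); rewrite /rowc /colc /= ?flatten_indexKl ?flatten_indexKr.
Qed.

Lemma cell_upleft x i j : i <= rowc mu x -> j <= colc mu x ->
  exists2 y : 'I_m, rowc mu y = i & colc mu y = j.
Proof.
move=> ile jle; apply: cell_exists; apply: leq_ltn_trans jle _.
by apply: leq_trans (colc_lt x) _; apply: part_nth_le.
Qed.

Lemma rowc_collen x : rowc mu x < collen mu (colc mu x).
Proof. by rewrite ltn_collen // colc_lt. Qed.

Lemma cell_exists_col i j : i < collen mu j -> exists2 x : 'I_m, rowc mu x = i & colc mu x = j.
Proof. by rewrite ltn_collen //; apply: cell_exists. Qed.

Lemma colc_lt_head x : colc mu x < head 0 mu.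
Proof.
by rewrite -nth0; apply: leq_trans (colc_lt x) _; apply: part_nth_le.
Qed.

Lemma big_column (R : Type) (idx : R) (op : Monoid.com_law idx) j (F : 'I_m -> R)
    (G : nat -> R) : (forall x, colc mu x = j -> F x = G (rowc mu x)) ->
  \big[op/idx]_(x : 'I_m | colc mu x == j) F x = \big[op/idx]_(i < collen mu j) G i.
Proof.
case: (posnP (collen mu j)) => [z|pos].
  rewrite z big_ord0 big_pred0 // => x; apply/negP => /eqP cx.
  by have := rowc_collen x; rewrite cx z.
have ex (i : 'I_(collen mu j)) : [exists x : 'I_m, (rowc mu x == i) && (colc mu x == j)].
  by have [x rx cx] := cell_exists_col (ltn_ord i); apply/existsP; exists x; rewrite rx cx !eqxx.
pose g i := xchoose (existsP (ex i)).
have gP i : rowc mu (g i) = i /\ colc mu (g i) = j.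
  by have /andP[/eqP -> /eqP ->] := xchooseP (existsP (ex i)).
(* The default [Ordinal pos] is never taken on column [j], whose cells have row numbers below
   [collen mu j]. *)
rewrite (reindex_onto g (fun x => insubd (Ordinal pos) (rowc mu x))) /=; last first.
  move=> x /eqP cx; apply: cell_inj; last by rewrite (gP _).2.
  by rewrite (gP _).1 insubdK // -cx; apply: rowc_collen.
move=> FG; apply: eq_big => [i|i _].
  have [rg cg] := gP i; rewrite cg eqxx /=; apply/eqP/val_inj.
  by rewrite insubdK rg //; apply: ltn_ord.
by have [rg cg] := gP i; rewrite FG // rg.
Qed.

End Cells.

(** * Semistandard fillings *)

(** The rearrangement inequality for one transposition: the gain is [(u y - u x) * (v x - v y)]. *)
Lemma swap_gain (I : finType) (u v : I -> nat) (x y : I) : u x < u y -> v y < v x ->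
  \sum_z u z * v z < \sum_z u z * v (tperm x y z).
Proof.
move=> ulxy vyx; have nxy : y != x by apply: contraTneq ulxy => ->; rewrite ltnn.
rewrite [ltnLHS](bigD1 x) //= (bigD1 y) //= [ltnRHS](bigD1 x) //= [X in _ < _ + X](bigD1 y) //=.
rewrite tpermL tpermR !addnA.
rewrite [X in _ < _ + X](eq_bigr (fun z => u z * v z)); last first.
  by move=> z /andP[zx zy]; rewrite tpermD // eq_sym.
by rewrite ltn_add2r; nia.
Qed.

Section SSYT.

Variables (m : nat) (mu : seq nat).
Implicit Types (x y z : 'I_m) (w : 'I_m -> nat).

Definition col_strict w := forall x y, colc mu x = colc mu y -> rowc mu x < rowc mu y -> w x < w y.
Definition row_weak w := forall x y, rowc mu x = rowc mu y -> colc mu x < colc mu y -> w x <= w y.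
Definition ssyt w := col_strict w /\ row_weak w.

Lemma col_strict_inj w x y : col_strict w -> colc mu x = colc mu y -> w x = w y -> x = y.
Proof.
move=> cw cxy wxy; apply: (cell_inj (mu := mu)) => //.
by case: (ltngtP (rowc mu x) (rowc mu y)) => // /cw; rewrite cxy wxy ltnn => /(_ erefl).
Qed.

(** In the row of [x], the permutation [r] matches the cells where [w] is at most [w' x] with those
    where [w'] is. If [w' x < w x], the former all lie strictly left of [x], while the latter
    contain these and [x] as well. *)
Lemma row_perm_le w w' (r : 'S_m) : row_weak w -> row_weak w' ->
  (forall x, rowc mu (r x) = rowc mu x) -> (forall x, w x = w' (r x)) ->
  forall x, w x <= w' x.
Proof.
move=> ww ww' rr wr x; rewrite leqNgt; apply/negP => lt.
pose A := [set z : 'I_m | (rowc mu z == rowc mu x) && (w z <= w' x)].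
pose B := [set z : 'I_m | (rowc mu z == rowc mu x) && (w' z <= w' x)].
have AB : A = r @^-1: B by apply/setP => z; rewrite !inE rr wr.
have cAB : #|A| = #|B| by rewrite AB card_preimset //; apply: perm_inj.
suff /proper_card : A \proper B by rewrite cAB ltnn.
apply/properP; split; last by exists x; rewrite inE eqxx ?leqnn //= -ltnNge.
apply/subsetP => z; rewrite !inE => /andP[/eqP rz wz]; rewrite rz eqxx /=.
have : colc mu z < colc mu x.
  rewrite ltnNge leq_eqVlt; apply/negP => /predU1P[e|/(ww x z (esym rz))]; last by lia.
  by rewrite -(cell_inj (esym rz) e) in wz; lia.
by move/(ww' z x rz).
Qed.

Lemma row_perm_eq w w' (r : 'S_m) : row_weak w -> row_weak w' ->
  (forall x, rowc mu (r x) = rowc mu x) -> (forall x, w x = w' (r x)) -> w =1 w'.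
Proof.
move=> ww ww' rr wr x; apply/eqP; rewrite eqn_leq (row_perm_le ww ww' rr wr).
apply: (row_perm_le (r := r^-1%g) ww' ww) => y; first by rewrite -[in RHS](permKV r y) rr.
by rewrite wr permKV.
Qed.

(* The gain in the column potential when a Garnir element replaces some small
   entries of column j.+1 by larger entries of column j. *)
Lemma exchange_gain w (X Y : {set 'I_m}) (s : 'S_m) j :
  {in X, forall x, colc mu x = j} -> {in Y, forall y, colc mu y = j.+1} ->
  {in X & Y, forall x y, w y < w x} -> perm_on (X :|: Y) s -> ~~ (s @: Y \subset Y) ->
  \sum_(x < m) colc mu x * w x < \sum_(x < m) colc mu x * w (s x).
Proof.
move=> cX cY XY sXY nsY.
have dXY : [disjoint X & Y].
  apply/pred0P => z; apply/negP => /= /andP[/cX cz /cY]; rewrite cz; lia.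
have bU (F : 'I_m -> nat) : \sum_(x in X :|: Y) F x = \sum_(x in X) F x + \sum_(x in Y) F x.
  by rewrite -bigU //; apply: eq_bigl => x; rewrite !inE.
(* Moving one copy of each value on [Y] into a separate sum gives all of [X :|: Y] the weight [j].
   As [s] permutes [X :|: Y] and fixes the rest, only the sum over [Y] can change. *)
have split_sum (v : 'I_m -> nat) : \sum_(x < m) colc mu x * v x =
    \sum_(x in ~: (X :|: Y)) colc mu x * v x + j * \sum_(x in X :|: Y) v x + \sum_(y in Y) v y.
  rewrite (bigID (fun x => x \in X :|: Y)) /= addnC -addnA; congr addn.
    by apply: eq_bigl => x; rewrite in_setC.
  rewrite !bU mulnDr !big_distrr /= -addnA -big_split /=; congr addn.
    by apply: eq_bigr => x /cX ->.
  by apply: eq_bigr => y /cY ->; rewrite mulSn addnC.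
rewrite !split_sum.
rewrite [X in _ < X + _ + _](eq_bigr (fun x => colc mu x * w x)); last first.
  by move=> x; rewrite inE => xn; rewrite (out_perm sXY).
have -> : \sum_(x in X :|: Y) w (s x) = \sum_(x in X :|: Y) w x.
  rewrite [RHS](reindex_inj (@perm_inj _ s)) /=; apply: eq_bigl => x.
  by rewrite (perm_closed _ sXY).
rewrite ltn_add2l -(big_imset w (in2W (@perm_inj _ s))) /=.
set Z := s @: Y.
rewrite (big_setID Z) [ltnRHS](big_setID Y) /= setIC ltn_add2l.
have cZY : #|Z :\: Y| = #|Y :\: Z|.
  by apply/(@addnI #|Z :&: Y|); rewrite cardsID setIC cardsID card_imset //; apply: perm_inj.
have [x0 x0Z] : exists x, x \in Z :\: Y.
  by apply/set0Pn; rewrite setD_eq0.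
have ZX : {subset Z :\: Y <= X}.
  move=> x; rewrite inE => /andP[xnY /imsetP[y yY xE]].
  have := perm_closed y sXY; rewrite -xE !inE yY orbT (negPf xnY) orbF => xX; exact: xX.
have [y0 y0Y] : exists y, y \in Y :\: Z.
  by apply/set0Pn; rewrite -card_gt0 -cZY card_gt0; apply/set0Pn; exists x0.
(* The values that leave [Y] are at most [v]; equally many enter from [X], each at least [v.+1]. *)
pose v := \max_(y in Y) w y.
apply: (@leq_ltn_trans (\sum_(y in Y :\: Z) v)).
  apply: leq_sum => y; rewrite inE => /andP[_ yY].
  by rewrite /v (bigD1 y) //= leq_maxl.
apply: (@leq_trans (\sum_(x in Z :\: Y) v.+1)).
  by rewrite !sum_nat_const cZY ltn_pmul2l // -cZY; apply/card_gt0P; exists x0.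
apply: leq_sum => x /ZX xX; have /setDP[y0Y' _] := y0Y.
have wx : 0 < w x := leq_ltn_trans (leq0n _) (XY _ _ xX y0Y').
rewrite -(prednK wx) ltnS; apply/bigmax_leqP => y yY.
by rewrite -ltnS prednK // XY.
Qed.

Hypothesis mu_m : is_part_of m mu.

Lemma row_weak_adjacent w :
  (forall x y, rowc mu x = rowc mu y -> colc mu y = (colc mu x).+1 -> w x <= w y) -> row_weak w.
Proof.
move=> adj x y; move dE: (colc mu y) => d; elim: d y dE => // d IH y dE rxy.
rewrite ltnS leq_eqVlt => /predU1P[cx|cx]; first by apply: adj; rewrite // dE cx.
have [z rz cz] : exists2 z : 'I_m, rowc mu z = rowc mu y & colc mu z = d.
  by apply: (cell_upleft mu_m) => //; rewrite dE.
apply: leq_trans (IH z cz _ cx) _; first by rewrite rxy.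
by apply: adj; rewrite ?dE ?cz.
Qed.

(** A strictly increasing map on an initial segment of the naturals never goes below the identity.
    Since [p] permutes the cells, row numbers have the same sum before and after, so no cell
    moves. *)
Lemma col_perm_row_mono (p : 'S_m) : (forall x, colc mu (p x) = colc mu x) ->
  (forall x y, colc mu x = colc mu y -> rowc mu x < rowc mu y -> rowc mu (p x) < rowc mu (p y)) ->
  p = 1%g.
Proof.
move=> pc pm.
have ge x : rowc mu x <= rowc mu (p x).
  move rE: (rowc mu x) => i; elim: i x rE => // i IH x rE.
  have [y ry cy] : exists2 y : 'I_m, rowc mu y = i & colc mu y = colc mu x.
    by apply: (cell_upleft mu_m) => //; rewrite rE.
  by apply: leq_ltn_trans (IH y ry) (pm y x cy _); rewrite ry rE.
have sumE : \sum_(x < m) (rowc mu (p x) - rowc mu x) = 0.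
  rewrite sumnB; last by move=> x _; apply: ge.
  by rewrite [X in _ - X](reindex_inj (@perm_inj _ p)) subnn.
apply/permP => x; rewrite perm1; apply: (cell_inj (mu := mu)); last exact: pc.
move/eqP: sumE; rewrite sum_nat_eq0 => /forallP/(_ x); rewrite implyTb subn_eq0 => le.
by apply/eqP; rewrite eqn_leq le ge.
Qed.

(** A maximiser of the row potential over the column stabiliser keeps the order of rows in each
    column, for otherwise a swap would increase the potential; so it is the identity. The assumed
    inequality makes [q] such a maximiser. *)
Lemma col_perm_potential w (q : 'S_m) : col_strict w -> (forall x, colc mu (q x) = colc mu x) ->
  \sum_(x < m) rowc mu x * w x <= \sum_(x < m) rowc mu x * w (q x) -> q = 1%g.
Proof.
move=> cw qc; pose P (p : 'S_m) := [forall x : 'I_m, colc mu (p x) == colc mu x].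
pose Phi (p : 'S_m) := \sum_(x < m) rowc mu x * w (p x).
have PP (p : 'S_m) : reflect (forall x, colc mu (p x) = colc mu x) (P p).
  by apply: (iffP forallP) => H x; apply/eqP.
have maxE (p : 'S_m) : P p -> (forall p', P p' -> Phi p' <= Phi p) -> p = 1%g.
  move=> /PP pc pmax; apply: col_perm_row_mono => // x y cxy rxy.
  rewrite ltnNge; apply/negP => ryx.
  have {ryx} : w (p y) <= w (p x).
    move: ryx; rewrite leq_eqVlt => /predU1P[e|/cw/ltnW -> //]; last by rewrite !pc.
    by rewrite (cell_inj e) // !pc.
  rewrite leq_eqVlt => /predU1P[e|wyx].
    have /perm_inj exy : p y = p x by apply: (col_strict_inj cw) => //; rewrite !pc.
    by rewrite exy ltnn in rxy.
  suff /pmax : P (tperm x y * p)%g.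
    rewrite leqNgt => /negP; apply; rewrite /Phi.
    under [ltnRHS]eq_bigr do rewrite permM.
    by apply: (swap_gain (u := fun x : 'I_m => rowc mu x) (v := fun x => w (p x))).
  by apply/PP => z; rewrite permM pc; case: tpermP => // ->.
have P1 : P 1%g by apply/PP => x; rewrite perm1.
have [p Pp pmax] := arg_maxnP Phi P1.
have p1 := maxE p Pp pmax.
move=> qmax; apply: maxE; first exact/PP.
move=> p' Pp'; apply: leq_trans (pmax p' Pp') _; rewrite p1.
by apply: leq_trans qmax; apply: eq_leq; apply: eq_bigr => x _; rewrite perm1.
Qed.

End SSYT.

Lemma count_ltn_iota k l : count (fun i => i < k) (iota 0 l) = minn k l.
Proof.
elim: l => [|l IH]; first by rewrite minn0.
by rewrite -addn1 iotaD count_cat IH /= add0n addn0; case: (ltnP l k); lia.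
Qed.

(** * Rearranging a filling with distinct entries in each column *)

Section GaleRyser.

Variables (n : nat) (nu : seq nat).
Hypothesis nu_n : is_part_of n nu.
Implicit Types (a b : 'I_n -> nat) (p : 'S_n).

Definition col_inj a := forall x y : 'I_n, colc nu x = colc nu y -> a x = a y -> x = y.

Lemma card_column (P : pred nat) j :
  #|[pred z : 'I_n | (colc nu z == j) && P (rowc nu z)]| = count P (iota 0 (collen nu j)).
Proof.
rewrite -sum1_card big_mkcondr.
rewrite (big_column nu_n _ (G := fun i => if P i then 1 else 0)) // -big_mkcond /=.
by rewrite -(big_mkord P (fun=> 1)) sum1_count /index_iota subn0.
Qed.

(** Pigeonhole: otherwise the values of [a] on the [P] part of column [c] would all occur on the
    smaller [Q] part of column [d]. *)
Lemma col_missing a c d (P Q : pred nat) : col_inj a ->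
  count Q (iota 0 (collen nu d)) < count P (iota 0 (collen nu c)) ->
  (forall u v : 'I_n, colc nu u = c -> P (rowc nu u) -> colc nu v = d -> a u = a v -> Q (rowc nu v)) ->
  exists u : 'I_n, [/\ colc nu u = c, P (rowc nu u) &
    forall v : 'I_n, colc nu v = d -> a u <> a v].
Proof.
move=> ainj; rewrite -!card_column => lt PQ.
pose A := [pred z : 'I_n | (colc nu z == c) && P (rowc nu z)].
pose B := [pred z : 'I_n | (colc nu z == d) && Q (rowc nu z)].
pose D := [pred z : 'I_n | colc nu z == d].
have [/existsP[u /andP[/andP[/eqP cu Pu] /forallP nu_]]|] :=
    boolP [exists u, (u \in A) && [forall v, (v \in D) ==> (a u != a v)]].
  exists u; split=> // v /eqP cv; apply/eqP; exact: (implyP (nu_ v)).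
rewrite negb_exists => /forallP H; exfalso; move: lt; apply/negP; rewrite -leqNgt.
have: size [seq a u | u <- enum A] <= size [seq a v | v <- enum B].
  apply: uniq_leq_size => [|_ /mapP[x xA0 ->]].
    rewrite map_inj_in_uniq ?enum_uniq // => x y; rewrite !mem_enum.
    by move=> /andP[/eqP cx _] /andP[/eqP cy _]; apply: ainj; rewrite cx cy.
  have xA : x \in A by rewrite -mem_enum.
  have /andP[/eqP cx Px] := xA.
  have := H x; rewrite xA /= negb_forall => /existsP[y].
  rewrite negb_imply negbK => /andP[/eqP yd /eqP axy].
  rewrite axy map_f // mem_enum inE yd eqxx /=; exact: (PQ x).
by rewrite !size_map -!cardE.
Qed.

(* The existence part of the Gale-Ryser theorem: a rearrangement maximising first
   the column potential and then the row potential is semistandard, for a row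
   descent would allow two entries to be exchanged between the two columns. *)
Lemma col_inj_ssyt a : col_inj a -> exists p : 'S_n, ssyt nu (fun x => a (p x)).
Proof.
move=> ainj.
pose P p := [forall x : 'I_n, forall y : 'I_n,
  (colc nu x == colc nu y) ==> (a (p x) == a (p y)) ==> (x == y)].
have PP p : reflect (col_inj (fun x => a (p x))) (P p).
  apply: (iffP forallP) => H x; last first.
    by apply/forallP => y; apply/implyP => /eqP c; apply/implyP => /eqP e; apply/eqP/H.
  move=> y /eqP c /eqP e; apply/eqP; exact: (implyP (implyP (forallP (H x) y) c) e).
pose Psi p := \sum_(x < n) colc nu x * a (p x).
pose Phi p := \sum_(x < n) rowc nu x * a (p x).
have P1 : P 1%g by apply/PP => x y cxy; rewrite !perm1; apply: ainj.
have [p0 Pp0 max0] := arg_maxnP Psi P1.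
have Q0 : P p0 && (Psi p0 == Psi p0) by rewrite Pp0 eqxx.
have [p /andP[Pp /eqP Ep] maxp] := arg_maxnP Phi (P := fun p => P p && (Psi p == Psi p0)) Q0.
exists p; set b := fun x => a (p x).
have bE (u v x : 'I_n) : a ((tperm u v * p)%g x) = b (tperm u v x) by rewrite permM.
have binj : col_inj b by apply/PP.
have cb : col_strict nu b.
  move=> x y cxy rxy; rewrite ltnNge leq_eqVlt; apply/negP => /predU1P[e|lt].
    by move: rxy; rewrite (binj x y cxy (esym e)) ltnn.
  suff /maxp : P (tperm x y * p)%g && (Psi (tperm x y * p)%g == Psi p0).
    rewrite /= leqNgt => /negP; apply; rewrite /Phi.
    under [ltnRHS]eq_bigr do rewrite bE.
    exact: (swap_gain (u := fun x : 'I_n => rowc nu x) (v := b)).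
  have tc z : colc nu (tperm x y z) = colc nu z by case: tpermP => // ->.
  apply/andP; split.
    apply/PP => z1 z2 c12; rewrite !bE => /binj /(@perm_inj _ (tperm x y)) -> //.
    by rewrite !tc.
  rewrite -Ep /Psi (reindex_inj (@perm_inj _ (tperm x y))) /=; apply/eqP.
  by apply: eq_bigr => z _; rewrite bE tpermK tc.
split=> //; apply: (row_weak_adjacent nu_n) => x y rxy cxy; rewrite leqNgt; apply/negP => byx.
have pnu : is_part nu by case/andP: nu_n.
have lx := rowc_collen nu_n x; have ly := rowc_collen nu_n y.
have ltc : collen nu (colc nu y) <= collen nu (colc nu x).
  rewrite cxy leqNgt; apply/negP => l; move: (l); rewrite ltn_collen // => l'.
  have : collen nu (colc nu x) < collen nu (colc nu x) by rewrite ltn_collen //; lia.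
  by rewrite ltnn.
have cnt_le k l : count (fun i => i <= k) (iota 0 l) = minn k.+1 l.
  by rewrite -count_ltn_iota; apply: eq_count => i; rewrite ltnS.
have cnt_ge k l : count (fun i => k <= i) (iota 0 l) = l - k.
  have := count_predC (fun i => i < k) (iota 0 l).
  rewrite size_iota count_ltn_iota.
  rewrite (eq_count (a2 := fun i => k <= i)); first by lia.
  by move=> i; rewrite /= -leqNgt.
have bmono (u v : 'I_n) : colc nu u = colc nu v -> b u < b v -> rowc nu u < rowc nu v.
  move=> cuv buv; rewrite ltnNge leq_eqVlt; apply/negP => /predU1P[e|/cb]; last by lia.
  by move: buv; rewrite (cell_inj e (esym cuv)) ltnn.
have bmono' (u v : 'I_n) : colc nu u = colc nu v -> rowc nu u <= rowc nu v -> b u <= b v.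
  move=> cuv; rewrite leq_eqVlt => /predU1P[e|/cb/ltnW]; last exact.
  by rewrite (cell_inj e cuv).
(* A value at or above [y] that also occurs in the column of [x] is below [b x], hence occurs
   strictly above [x], where there is one cell too few. The same count at and below [x] then yields
   [u]. *)
have [v [cv rv vn]] : exists v : 'I_n, [/\ colc nu v = colc nu y, rowc nu v <= rowc nu y &
    forall u : 'I_n, colc nu u = colc nu x -> b v <> b u].
  apply: (col_missing (Q := fun i => i < rowc nu x) (P := fun i => i <= rowc nu y)) => //.
    by rewrite cnt_le count_ltn_iota rxy; lia.
  move=> v u cv rv cu vu; apply: bmono => //.
  by rewrite -vu; apply: leq_ltn_trans byx; apply: bmono'.
have [u [cu ru un]] : exists u : 'I_n, [/\ colc nu u = colc nu x, rowc nu x <= rowc nu u &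
    forall v : 'I_n, colc nu v = colc nu y -> b u <> b v].
  apply: (col_missing (Q := fun i => (rowc nu y).+1 <= i) (P := fun i => rowc nu x <= i)) => //.
    by rewrite !cnt_ge rxy; lia.
  move=> u' v' cu ru cv' vu; apply: bmono => //.
  by rewrite -vu; apply: leq_trans byx _; apply: bmono'.
have buv : b v < b u.
  have vy : b v <= b y by apply: bmono'.
  have xu : b x <= b u by apply: bmono'.
  lia.
(* Neither [b u] nor [b v] occurs in the other column, so exchanging them keeps columns injective;
   it moves the larger value to the right and contradicts the maximality of [Psi]. *)
suff /max0 : P (tperm u v * p)%g.
  rewrite -Ep /= leqNgt => /negP; apply; rewrite /Psi.
  under [ltnRHS]eq_bigr do rewrite bE.
  by apply: (swap_gain (u := fun x : 'I_n => colc nu x) (v := b)) => //; rewrite cu cv cxy.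
apply/PP => z1 z2 c12; rewrite !bE.
case: (tpermP u v z1) => [z1E|z1E|_ _]; case: (tpermP u v z2) => [z2E|z2E|_ _] //;
  rewrite ?z1E ?z2E //.
- by move: c12; rewrite z1E z2E cu cv cxy; lia.
- by move/vn; rewrite -c12 z1E cu => /(_ erefl).
- by move: c12; rewrite z1E z2E cu cv cxy; lia.
- by move/un; rewrite -c12 z1E cv => /(_ erefl).
- by move/esym/vn; rewrite c12 z2E cu => /(_ erefl).
- by move/esym/un; rewrite c12 z2E cv => /(_ erefl).
- exact: binj.
Qed.

End GaleRyser.

(** * Tabloids as words *)

Lemma col_stab1P r la (q : 'S_r) : 
  reflect (forall x : 'I_r, colc la (q x) = colc la x) (q \in col_stab la 1%g).
Proof.
rewrite inE; apply: (iffP forallP) => H x; have := H x; rewrite /col_of invg1 !perm1.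
  by move/eqP.
by move=> e; apply/eqP.
Qed.

Lemma row_of1 r la (x : 'I_r) : row_of la 1%g x = rowc la x.
Proof. by rewrite /row_of invg1 perm1. Qed.

Lemma rowc_cons a la x : rowc (a :: la) x = if x < a then 0 else (rowc la (x - a)).+1.
Proof.
rewrite /rowc /reshape_index /= subn_eq0; case: ltnP => // ax.
by rewrite subSn.
Qed.

Lemma rowc_ltn la x k : x < sumn la -> (rowc la x < k) = (x < sumn (take k la)).
Proof.
elim: la x k => [|a la IH] x [|k] //=.
rewrite rowc_cons => xlt; case: (ltnP x a) => [xa|ax]; first by rewrite ltn_addr.
by rewrite ltnS IH; lia.
Qed.

Lemma card_ltn_ord r s : s <= r -> #|[pred x : 'I_r | x < s]| = s.
Proof.
move=> sr; rewrite -sum1_card -(big_mkord (fun x => (x < s)) (fun=> 1)).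
by rewrite sum1_count /index_iota subn0 count_ltn_iota; apply/minn_idPl.
Qed.

(** * Row sizes of tabloids *)

Section RowContent.

Variables (r : nat) (la : seq nat).
Hypothesis la_r : is_part_of r la.

Lemma sumn_take_le k : sumn (take k la) <= r.
Proof.
by case/andP: la_r => _ /eqP <-; rewrite -{2}(cat_take_drop k la) sumn_cat leq_addr.
Qed.

Lemma card_row_ltn (u : 'S_r) k : #|[pred x | row_of la u x < k]| = sumn (take k la).
Proof.
rewrite -(card_ltn_ord (sumn_take_le k)) -[LHS]cardsE -[RHS]cardsE.
rewrite -[RHS](card_preimset (f := u^-1%g) _ (@perm_inj _ u^-1%g)).
apply: eq_card => x; rewrite !inE.
by case/andP: la_r => _ /eqP e; rewrite -rowc_ltn ?e.
Qed.

Lemma card_row (u : 'S_r) j : #|[pred x | row_of la u x == j]| = nth 0 la j.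
Proof.
have := card_row_ltn u j.+1; have := card_row_ltn u j.
rewrite -[in X in X -> _]cardsE => ej; rewrite -[in X in X -> _]cardsE => ejS.
rewrite -[LHS]cardsE; have := cardsID [set x | (row_of la u x < j)] [set x | (row_of la u x < j.+1)].
have -> : [set x | (row_of la u x < j.+1)] :&: [set x | (row_of la u x < j)] =
   [set x | (row_of la u x < j)] by apply/setP => x; rewrite !inE; lia.
have -> : [set x | (row_of la u x < j.+1)] :\: [set x | (row_of la u x < j)] =
   [set x | row_of la u x == j] by apply/setP => x; rewrite !inE; lia.
rewrite ej ejS.
case: (ltnP j (size la)) => jl; last first.
  rewrite nth_default // !take_oversize ?(leqW jl) // => /eqP.
  by rewrite -[X in _ == X]addn0 eqn_add2l => /eqP.
by rewrite (take_nth 0 jl) sumn_rcons => /addnI.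
Qed.

End RowContent.

Lemma big_columns (R : Type) (idx : R) (op : Monoid.com_law idx) r la (F : 'I_r -> R) :
  is_part_of r la ->
  \big[op/idx]_x F x = \big[op/idx]_(j < head 0 la) \big[op/idx]_(x : 'I_r | colc la x == j) F x.
Proof.
move=> la_r; rewrite (partition_big (fun x => Ordinal (colc_lt_head la_r x)) xpredT) //=.
Qed.

(** * Dominance from words with distinct letters in each column *)

Section ColumnStrict.

Variables (r : nat) (la mu : seq nat).
Hypotheses (la_r : is_part_of r la) (mu_r : is_part_of r mu).
Variable u : 'S_r.
Let w x := row_of mu u x.
Hypothesis winj : forall x y : 'I_r, colc la x = colc la y -> w x = w y -> x = y.

Let colcount j k := #|[pred x : 'I_r | (colc la x == j) && (w x < k)]|.

Lemma colcount_le j k : colcount j k <= minn k (collen la j).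
Proof.
rewrite leq_min; apply/andP; split; last first.
  have := card_column la_r xpredT j; rewrite count_predT size_iota => <-.
  by apply/subset_leq_card/subsetP => x; rewrite !inE andbT => /andP[].
have := @uniq_leq_size _ [seq w x | x <- enum [pred x : 'I_r | (colc la x == j) && (w x < k)]] (iota 0 k).
rewrite size_map -cardE size_iota; apply.
  rewrite map_inj_in_uniq ?enum_uniq // => x y; rewrite !mem_enum.
  by move=> /andP[/eqP cx _] /andP[/eqP cy _]; apply: winj; rewrite cx cy.
move=> _ /mapP[x xA ->]; move: xA; rewrite mem_enum => /andP[_ wx].
by rewrite mem_iota.
Qed.

Lemma sum_colcount k : \sum_(j < head 0 la) colcount j k = sumn (take k mu).
Proof.
rewrite -(card_row_ltn mu_r u k) -sum1_card [RHS]big_mkcond (big_columns _ _ la_r) /=.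
by apply: eq_bigr => j _; rewrite -big_mkcondr /colcount -sum1_card; apply: eq_bigl => x.
Qed.

Lemma sum_min_collen k : \sum_(j < head 0 la) minn k (collen la j) = sumn (take k la).
Proof.
rewrite -(card_row_ltn la_r 1 k) -sum1_card [RHS]big_mkcond (big_columns _ _ la_r) /=.
apply: eq_bigr => j _; rewrite -count_ltn_iota -(card_column la_r) -big_mkcondr -sum1_card.
by apply: eq_bigl => x; rewrite !inE row_of1.
Qed.

(** The basic combinatorial lemma on dominance: the letters below [k] in a column are distinct, so
    there are at most as many as cells in its first [k] rows. Summing over columns compares the
    partial sums of [mu] and [la]. *)
Lemma col_distinct_dominates : dominates la mu.
Proof. by move=> k; rewrite -sum_colcount -sum_min_collen leq_sum // => j _; apply: colcount_le. Qed.

(** When the shapes agree, all the column bounds are equalities, so each column holds exactly the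
    letters [0, 1, ...] up to its length. Sending every cell to the row named by its letter is then
    a column permutation. *)
Lemma col_distinct_factor : la = mu -> exists2 q, q \in col_stab la 1%g & row_of mu u =1 row_of la q.
Proof.
move=> lamu.
have wlt x : (w x < collen la (colc la x)).
  rewrite ltnNge; apply/negP => lex; set j := colc la x in lex; set k := collen la j in lex.
  have jl : (j < head 0 la) := colc_lt_head la_r x.
  have : (sumn (take k mu) < sumn (take k la)).
    rewrite -sum_colcount -sum_min_collen (bigD1 (Ordinal jl)) //= [ltnRHS](bigD1 (Ordinal jl)) //=.
    rewrite -addSn leq_add //; last by apply: leq_sum => i _; apply: colcount_le.
    rewrite -/k minnn; have := card_column la_r xpredT j; rewrite count_predT size_iota -/k => cE.
    rewrite -[X in _ < X]cE; apply/proper_card/properP; split.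
      by apply/subsetP => y; rewrite !inE andbT => /andP[].
    by exists x; rewrite !inE eqxx //= -leqNgt.
  by rewrite lamu ltnn.
have ex x : exists y : 'I_r, rowc la y = w x /\ colc la y = colc la x.
  by have [y ? ?] := cell_exists_col la_r (wlt x); exists y.
have [p pE] := fin_all_exists (U := fun=> 'I_r) ex.
have pinj : injective p.
  move=> x y e; have [rx cx] := pE x; have [ry cy] := pE y.
  by apply: winj; [rewrite -cx -cy e | rewrite -rx -ry e].
exists (perm pinj)^-1%g => [|x]; last first.
  by have [rx _] := pE x; rewrite -[LHS]/(w x) -rx /row_of invgK permE.
apply/col_stab1P => x; have [_ cx] := pE ((perm pinj)^-1%g x).
by rewrite -cx -[p _](permE pinj) permKV.
Qed.

End ColumnStrict.

(** * Cycle type and conjugacy *)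

Section CycleType.

Variable r : nat.
Implicit Types (s u : 'S_r) (X : {set 'I_r}).

Definition cycles s : seq {set 'I_r} := sort (relpre (fun X => #|X|) geq) (enum (porbits s)).
Definition ctype s : seq nat := [seq #|X| | X : {set 'I_r} <- cycles s].

Lemma mem_cycles s X : (X \in cycles s) = (X \in porbits s).
Proof. by rewrite mem_sort mem_enum. Qed.

Lemma sumn_ctype s : sumn (ctype s) = r.
Proof.
rewrite sumnE big_map (perm_big (enum (porbits s))) ?perm_sort // big_enum /=.
rewrite -[RHS]card_ord -sum1_card (partition_big (porbit s) (mem (porbits s))) /=; last first.
  by move=> x _; apply: imset_f.
apply: eq_bigr => _ /imsetP[y _ ->]; rewrite -sum1_card; apply: eq_bigl => x.
by rewrite eq_porbit_mem.
Qed.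

Lemma ctype_part s : is_part_of r (ctype s).
Proof.
rewrite /is_part_of sumn_ctype eqxx andbT; apply/andP; split.
  by rewrite /ctype sorted_map; apply: sort_sorted => X Y; apply: leq_total.
apply/mapP => -[X]; rewrite mem_cycles => /imsetP[x _ ->] /esym/eqP.
by rewrite (negPf (card_porbit_neq0 s x)).
Qed.

Definition cycle_seq s X : seq 'I_r :=
  if [pick x in X] is Some x then traject s x #|X| else [::].

Lemma cycle_seqP s X : X \in porbits s ->
  exists2 x, X = porbit s x & cycle_seq s X = traject s x #|porbit s x|.
Proof.
case/imsetP => y _ ->; rewrite /cycle_seq; case: pickP => [x xy|/(_ y)]; last by rewrite porbit_id.
have e : porbit s x = porbit s y by apply/eqP; rewrite eq_porbit_mem.
by exists x; rewrite e.
Qed.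

Definition cycle_list s : seq 'I_r := flatten [seq cycle_seq s X | X <- cycles s].

Lemma shape_cycle_list s : shape [seq cycle_seq s X | X <- cycles s] = ctype s.
Proof.
rewrite /shape -map_comp; apply/eq_in_map => X; rewrite mem_cycles => /cycle_seqP[x -> /= ->].
by rewrite size_traject.
Qed.

Lemma size_cycle_list s : size (cycle_list s) = r.
Proof. by rewrite size_flatten shape_cycle_list sumn_ctype. Qed.

Lemma mem_cycle_list s x : x \in cycle_list s.
Proof.
have Xs : porbit s x \in porbits s by apply: imset_f.
apply/flatten_mapP; exists (porbit s x); first by rewrite mem_cycles.
by have [y e ->] := cycle_seqP Xs; rewrite -porbit_traject -e porbit_id.
Qed.

Lemma uniq_cycle_list s : uniq (cycle_list s).
Proof.
rewrite (@uniq_size_uniq _ (enum 'I_r)) ?enum_uniq //; last first.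
  by move=> x; rewrite mem_enum mem_cycle_list.
by rewrite size_cycle_list size_enum_ord.
Qed.

Definition next_index (sh : seq nat) (i : nat) : nat :=
  let a := reshape_index sh i in let b := reshape_offset sh i in
  flatten_index sh a (if b.+1 < nth 0 sh a then b.+1 else 0).

Lemma next_index_lt sh i : i < sumn sh -> next_index sh i < sumn sh.
Proof.
move=> ilt; apply: flatten_indexP; case: ifP => // _.
exact: leq_ltn_trans (leq0n _) (reshape_offsetP ilt).
Qed.

Lemma cycle_list_next s x0 i : i < r ->
  s (nth x0 (cycle_list s) i) = nth x0 (cycle_list s) (next_index (ctype s) i).
Proof.
move=> ilt; have isum : i < sumn (ctype s) by rewrite sumn_ctype.
have alt := reshape_indexP isum; have blt := reshape_offsetP isum.
rewrite /cycle_list !nth_flatten shape_cycle_list /next_index.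
set a := reshape_index _ i in alt blt *; set b := reshape_offset _ i in blt *.
have b'lt : (if b.+1 < nth 0 (ctype s) a then b.+1 else 0) < nth 0 (ctype s) a.
  by case: ifP => // _; apply: leq_ltn_trans blt.
rewrite (flatten_indexKl b'lt) (flatten_indexKr b'lt).
have alt' : a < size (cycles s) by move: alt; rewrite size_map.
rewrite (nth_map set0) //.
have Xs : nth set0 (cycles s) a \in porbits s by rewrite -mem_cycles mem_nth.
have nE : nth 0 (ctype s) a = #|nth set0 (cycles s) a| by rewrite (nth_map set0).
have [x e ->] := cycle_seqP Xs; rewrite nE e in blt b'lt *.
rewrite !(set_nth_default x x0) ?size_traject // nth_traject // -iterS.
case: ltnP => [lt|ge]; first by rewrite nth_traject.
have -> : b.+1 = #|porbit s x| by apply/eqP; rewrite eqn_leq blt ge.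
by rewrite iter_porbit nth_traject // lt0n card_porbit_neq0.
Qed.

(* By cycle_list_next, s acts on the positions in cycle_list s by next_index,
   which depends on the cycle type only. *)
Lemma ctype_conj s u : ctype s = ctype u -> exists g, u = (s ^ g)%g.
Proof.
(* The conjugating permutation matches the two cycle lists position by position. *)
move=> esu; pose f (x : 'I_r) := nth x (cycle_list u) (index x (cycle_list s)).
have idx x : index x (cycle_list s) < r by rewrite -[X in _ < X](size_cycle_list s) index_mem mem_cycle_list.
have finj : injective f.
  move=> x y; rewrite /f (set_nth_default y) ?size_cycle_list ?idx // => /eqP.
  rewrite nth_uniq ?size_cycle_list ?idx ?uniq_cycle_list // => /eqP e.
  by rewrite -(nth_index x (mem_cycle_list s x)) e nth_index ?mem_cycle_list.
exists (perm finj); apply/permP => y.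
have [x ->] : exists x, y = perm finj x by exists ((perm finj)^-1%g y); rewrite permKV.
rewrite conjgE !permM permK !permE /f.
rewrite [in RHS](set_nth_default x) ?size_cycle_list ?idx //.
rewrite (cycle_list_next u) ?idx //; congr nth; rewrite -esu.
rewrite -{2}(nth_index x (mem_cycle_list s x)) cycle_list_next ?idx //.
rewrite index_uniq ?uniq_cycle_list // size_cycle_list -[X in _ < X](sumn_ctype s).
by rewrite next_index_lt ?sumn_ctype.
Qed.

(** Inversion keeps the orbits, hence the cycle type. This makes the characters of symmetric groups
    invariant under inversion. *)
Lemma conj_inv s : exists g, (s^-1 = s ^ g)%g.
Proof. by apply: ctype_conj; rewrite /ctype /cycles porbitsV. Qed.

End CycleType.

(** * Tableau families as words *)

Lemma nth_conj_part mu j : j < head 0 mu -> nth 0 (conj_part mu) j = collen mu j.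
Proof. by move=> jl; rewrite /conj_part (nth_map 0) ?size_iota // nth_iota. Qed.

Lemma size_conj_part mu : size (conj_part mu) = head 0 mu.
Proof. by rewrite size_map size_iota. Qed.

Section TableauEntries.

Variables (m : nat) (mu : seq nat).
Hypothesis mu_m : is_part_of m mu.
Implicit Types (t : tableau) (x y : 'I_m).

(** The tableau is read transposed: its rows are the columns of [mu], which turns
    conjugate-semistandard tableaux of shape [conj_part mu] into semistandard fillings of [mu]. *)
Definition entry t x : nat := nth 0 (nth [::] t (colc mu x)) (rowc mu x).

Lemma size_shape_conj t : shape t = conj_part mu -> size t = head 0 mu.
Proof. by move=> st; rewrite -(size_map size t) -/(shape t) st size_conj_part. Qed.

Lemma size_row_conj t j : shape t = conj_part mu -> j < head 0 mu -> size (nth [::] t j) = collen mu j.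
Proof. by move=> st jl; rewrite -nth_shape st nth_conj_part. Qed.

Lemma count_entry t j : shape t = conj_part mu ->
  count_mem j (flatten t) = \sum_(x < m) (entry t x == j).
Proof.
move=> st; rewrite count_flatten sumnE big_map (big_nth [::]) big_mkord size_shape_conj //.
rewrite (big_columns _ _ mu_m); apply: eq_bigr => c _.
rewrite (big_column mu_m _ (G := fun i => (nth 0 (nth [::] t c) i == j) : nat)); last first.
  by move=> x cx; rewrite /entry cx.
rewrite -sum1_count (big_nth 0) big_mkord size_row_conj // [LHS]big_mkcond /=.
by apply: eq_bigr => i _; case: eqP.
Qed.

Lemma entry_inj t t' : shape t = conj_part mu -> shape t' = conj_part mu ->
  entry t =1 entry t' -> t = t'.
Proof.
move=> st st' e; apply: (@eq_from_nth _ [::]) => [|j]; first by rewrite !size_shape_conj.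
rewrite size_shape_conj // => jl.
apply: (@eq_from_nth _ 0) => [|i]; first by rewrite !size_row_conj.
rewrite size_row_conj // => il; have [x rx cx] := cell_exists_col mu_m il.
by have := e x; rewrite /entry rx cx.
Qed.

Lemma entry_gt0 t x : conj_semistandard (conj_part mu) t -> 0 < entry t x.
Proof.
case/and4P => /eqP st /allP pos _ _; have cx := colc_lt_head mu_m x.
have tx : nth [::] t (colc mu x) \in t by apply: mem_nth; rewrite size_shape_conj.
have /allP rpos := pos _ tx.
by apply: rpos; apply: mem_nth; rewrite size_row_conj // rowc_collen.
Qed.

(** Strict rows become strict columns and weak columns become weak rows. Passing to predecessors
    keeps strictness because the entries are positive. *)
Lemma entry_ssyt t : conj_semistandard (conj_part mu) t -> ssyt mu (fun x => (entry t x).-1).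
Proof.
move=> css; have gt0 x := entry_gt0 x css.
case/and4P: css => /eqP st _ /allP srow /(sortedP [::]) scol.
split=> [x y cxy rxy|].
  suff : entry t x < entry t y by have := gt0 x; lia.
  rewrite /entry cxy; apply: (sorted_ltn_nth ltn_trans) => //.
  - by apply/srow/mem_nth; rewrite size_shape_conj // colc_lt_head.
  - by rewrite inE size_row_conj ?colc_lt_head // -cxy rowc_collen.
  - by rewrite inE size_row_conj ?colc_lt_head // rowc_collen.
apply: (row_weak_adjacent mu_m) => x y rxy cxy.
suff : entry t x <= entry t y by lia.
have cy := colc_lt_head mu_m y.
have lt : (colc mu x).+1 < size t by rewrite size_shape_conj // -cxy.
have /allP/(_ (rowc mu y)) := scol _ lt.
rewrite mem_iota /= -cxy size_row_conj // rowc_collen // => /(_ isT).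
by rewrite /entry rxy.
Qed.

(* The sum has one term, the value of w at the cell in row i and column j; words
   have letters 0, 1, ... whereas the entries of tableaux start at 1. *)
Definition tableau_of (w : 'I_m -> nat) : tableau :=
  [seq [seq (\sum_(x < m | (colc mu x == j) && (rowc mu x == i)) w x).+1
         | i <- iota 0 (collen mu j)] | j <- iota 0 (head 0 mu)].

Lemma shape_tableau_of w : shape (tableau_of w) = conj_part mu.
Proof.
by rewrite /shape -map_comp; apply: eq_map => j; rewrite /= size_map size_iota.
Qed.

Lemma entry_tableau_of w x : nth 0 (nth [::] (tableau_of w) (colc mu x)) (rowc mu x) = (w x).+1.
Proof.
rewrite (nth_map 0) ?size_iota ?colc_lt_head // nth_iota ?colc_lt_head // add0n.
rewrite (nth_map 0) ?size_iota ?rowc_collen // nth_iota ?rowc_collen // add0n.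
rewrite (big_pred1 x) // => y; apply/andP/eqP => [[/eqP cy /eqP ry]|->]; last by rewrite !eqxx.
exact: cell_inj ry cy.
Qed.

Lemma tableau_of_css w : ssyt mu w -> conj_semistandard (conj_part mu) (tableau_of w).
Proof.
move=> [cw rw]; have st := shape_tableau_of w.
apply/and4P; split; first exact/eqP.
- apply/allP => _ /mapP[j _ ->]; apply/allP => _ /mapP[i _ ->] //.
- apply/(all_nthP [::]) => j; rewrite size_shape_conj // => jl.
  apply/(sortedP 0) => i; rewrite size_row_conj // => il.
  have [y ry cy] := cell_exists_col mu_m il.
  have [x rx cx] := cell_exists_col mu_m (ltnW il).
  have := entry_tableau_of w x; have := entry_tableau_of w y; rewrite rx cx ry cy => -> ->.
  by rewrite /= ltnS cw ?cx ?cy ?rx ?ry.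
apply/(sortedP [::]) => j; rewrite size_shape_conj // => jl.
apply/allP => i; rewrite mem_iota size_row_conj //= add0n => il.
have [y ry cy] := cell_exists_col mu_m il.
have [x rx cx] : exists2 x : 'I_m, rowc mu x = i & colc mu x = j.
  by apply: (cell_upleft mu_m (x := y)); rewrite ?ry ?cy.
have := entry_tableau_of w x; have := entry_tableau_of w y; rewrite rx cx ry cy => -> ->.
by rewrite ltnS rw ?cx ?cy ?rx ?ry.
Qed.

End TableauEntries.

(** A word of content [la] is a rearrangement of [rowc la]; the inverse of the rearranging
    permutation is the tableau. This identifies words with tabloids. *)
Lemma word_tabloid r la (w : 'I_r -> nat) : is_part_of r la ->
  (forall j, #|[pred x | w x == j]| = nth 0 la j) -> exists t : 'S_r, row_of la t =1 w.
Proof.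
move=> la_r wE.
pose s := [tuple w x | x < r]; pose s0 := [tuple rowc la x | x < r].
have cnt (v : 'I_r -> nat) j : count_mem j [tuple v x | x < r] = #|[pred x | v x == j]|.
  by rewrite /= count_map cardE -size_filter enumT.
have /tuple_permP[p pE] : perm_eq s s0.
  apply/allP => j _ /=; rewrite !cnt wE -(card_row la_r 1%g j).
  by apply/eqP/eq_card => x; rewrite !inE row_of1.
exists p^-1%g => x; rewrite /row_of invgK.
have := congr1 (fun l => nth 0 l x) pE.
by rewrite !nth_mktuple tnth_mktuple => ->.
Qed.

Lemma bigmax_attained (T : eqType) (s : seq T) (F : T -> nat) :
  0 < \max_(i <- s) F i -> exists2 i, i \in s & F i = \max_(i <- s) F i.
Proof.
elim: s => [|a s IH]; first by rewrite big_nil.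
rewrite big_cons; case: (leqP (\max_(i <- s) F i) (F a)) => [le _|lt _].
  by exists a; rewrite ?mem_head //; apply/esym/maxn_idPl.
have [|i si iE] := IH; first exact: leq_ltn_trans lt.
by exists i; rewrite ?inE ?si ?orbT // iE; apply/esym/maxn_idPr/ltnW.
Qed.

(** The weight is as long as the greatest entry, which does occur, so its last term is nonzero. The
    parts of [la] are positive, so agreement of all terms forces equal lengths. Entries start at 1
    and list positions at 0, whence [j.+1]. *)
Lemma weightP (Ts : seq {fset tableau}) la : is_part la ->
  weight Ts = la <-> forall j, occurrences Ts j.+1 = nth 0 la j.
Proof.
move=> pla; set M := greatest_entry Ts.
have big j : M < j -> occurrences Ts j = 0.
  move=> Mj; rewrite /occurrences big_seq big1 // => T TTs; rewrite big_seq big1 // => t tT.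
  apply/count_memPn; apply/negP => jt; move: Mj; rewrite ltnNge => /negP[].
  rewrite /M /greatest_entry (big_rem T) //= leq_max (big_rem t) //= leq_max.
  by rewrite (big_rem j) //= leq_max leqnn.
have at_max : 0 < M -> 0 < occurrences Ts M.
  move=> M0; have [T TTs TE] := bigmax_attained M0.
  have [|t tT tE] := bigmax_attained (s := T) (F := fun t => \max_(x <- flatten t) x); first by rewrite TE.
  have [|x xt xE] := bigmax_attained (s := flatten t) (F := id); first by rewrite /= tE TE.
  have xM : x = M by rewrite [x]xE tE TE.
  rewrite /occurrences (big_rem T) //= (big_rem t) //= -!addnA ltn_addr //.
  by rewrite -has_count has_pred1 -xM.
split=> [<- j|occ].
  case: (ltnP j M) => [jM|Mj]; last by rewrite nth_default ?big // size_map size_iota.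
  by rewrite (nth_map 0) ?size_iota // nth_iota.
have sz : size la = M.
  apply/eqP; rewrite eqn_leq; apply/andP; split.
    rewrite leqNgt; apply/negP => lt; have := big _ (leqnn M.+1); rewrite occ => /eqP.
    by apply/negP; rewrite -lt0n part_nth_gt0.
  case: (posnP M) => [->//|M0]; have := at_max M0.
  by rewrite -(prednK M0) occ part_nth_gt0.
apply: (@eq_from_nth _ 0); first by rewrite size_map size_iota.
move=> j; rewrite size_map size_iota => jM.
by rewrite (nth_map 0) ?size_iota // nth_iota // add1n occ.
Qed.

(** * Elements of the wreath product *)

Section WreathElements.

Variables m n : nat.
Implicit Types (g : 'I_n -> 'S_m) (h : 'S_n).

Definition wr_fun g h (i : 'I_(m * n)) : 'I_(m * n) :=
  mxvec_index (g (blk i) (pos i)) (h (blk i)).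

Lemma wr_fun_inj g h : injective (wr_fun g h).
Proof.
move=> i j e; have := congr1 (@blk m n) e; rewrite !blkE => /perm_inj b.
have := congr1 (@pos m n) e; rewrite !posE b => /perm_inj p.
by rewrite -(cellK i) -(cellK j) b p.
Qed.

Definition wr_elt g h : 'S_(m * n) := perm (@wr_fun_inj g h).

Lemma wr_eltE g h x k : wr_elt g h (mxvec_index x k) = mxvec_index (g k x) (h k).
Proof. by rewrite permE /wr_fun posE blkE. Qed.

Lemma wr_elt_wreath g h : wr_elt g h \in wreath m n.
Proof. by apply/wreathP => i j ij; rewrite !permE !blkE ij. Qed.

Lemma wr_elt_base g h k : wr_base (wr_elt g h) k = g k.
Proof.
apply/permP => x; have := wr_baseE (mxvec_index x k) (wr_elt_wreath g h).
by rewrite wr_eltE !posE blkE.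
Qed.

Lemma wr_elt_top g h : (0 < m)%N -> wr_top (wr_elt g h) = h.
Proof.
move=> m0; apply/permP => k.
have := wr_topE (mxvec_index (Ordinal m0) k) (wr_elt_wreath g h).
by rewrite wr_eltE !blkE.
Qed.

Lemma wreathE s x k : s \in wreath m n ->
  s (mxvec_index x k) = mxvec_index (wr_base s k x) (wr_top s k).
Proof. by move=> Ws; rewrite -[LHS]cellK wr_baseE // wr_topE // posE blkE. Qed.

Definition block_perm k (q : 'S_m) := wr_elt (fun l => if l == k then q else 1%g) 1%g.

Lemma block_permE k q x l :
  block_perm k q (mxvec_index x l) = mxvec_index (if l == k then q x else x) l.
Proof. by rewrite wr_eltE perm1; case: eqP; rewrite ?perm1. Qed.

Lemma mxvec_index_inj (x y : 'I_m) (k l : 'I_n) :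
  mxvec_index x k = mxvec_index y l -> x = y /\ k = l.
Proof. by move=> e; rewrite -(posE x k) -[in k = l](blkE x k) e posE blkE. Qed.

Lemma block_perm_tperm k x y :
  block_perm k (tperm x y) = tperm (mxvec_index x k) (mxvec_index y k).
Proof.
apply/permP => i; rewrite -(cellK i) block_permE; set z := pos i; set l := blk i.
case: eqP => [->|nlk]; last first.
  by rewrite tpermD //; apply/eqP => /mxvec_index_inj[_ e]; apply: nlk.
case: (tpermP x y z) => [->|->|zx zy]; rewrite ?tpermL ?tpermR //.
by rewrite tpermD //; apply/eqP => /mxvec_index_inj[e _]; [apply: zx | apply: zy].
Qed.

Lemma big_blocks (R : Type) (idx : R) (op : Monoid.com_law idx) (f : 'I_(m * n) -> R) :
  \big[op/idx]_i f i = \big[op/idx]_k \big[op/idx]_x f (mxvec_index x k).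
Proof.
rewrite exchange_big pair_bigA /= (reindex (fun p : 'I_m * 'I_n => mxvec_index p.1 p.2)) //=.
exists (@cell m n) => [[x k] _|i _]; first by rewrite mxvec_indexK.
by rewrite -[RHS](cellK i).
Qed.

End WreathElements.

Section TupleWord.

Variables (m n : nat) (mu nu la : seq nat).
Hypotheses (mu_m : is_part_of m mu) (nu_n : is_part_of n nu).

(** Block [k] carries one tableau of a family tuple; the cell [k] of [nu] tells which: its column is
    the index of the family, and tableaux of the same family have to differ. *)
Definition family_word (t : 'S_(m * n)) : Prop :=
  (forall k, ssyt mu (fun x => row_of la t (mxvec_index x k))) /\
  (forall k l : 'I_n, k != l -> colc nu k = colc nu l ->
     exists x, row_of la t (mxvec_index x k) <> row_of la t (mxvec_index x l)).

(** The block numbered by the cell in row [i] and column [c] of [nu] receives the [i]-th tableau of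
    family [c], with entries lowered by one. The weight is the content of the resulting word, so
    [word_tabloid] applies. *)
Lemma tuple_word (Ts : seq {fset tableau}) : is_part la ->
  css_family_tuple (conj_part mu) (conj_part nu) Ts -> weight Ts = la ->
  is_part_of (m * n) la /\ exists t, family_word t.
Proof.
move=> pla css /(weightP _ pla) occ.
have szT : size Ts = head 0 nu.
  by move: css; rewrite /css_family_tuple all2E size_conj_part => /andP[/eqP].
have Tcss c : c < head 0 nu ->
    size (nth fset0 Ts c) = collen nu c /\ all (conj_semistandard (conj_part mu)) (nth fset0 Ts c).
  move=> cl; move: css; rewrite /css_family_tuple all2E => /andP[_ /(all_nthP (fset0, 0))/(_ c)].
  rewrite size_zip szT size_conj_part minnn => /(_ cl).
  rewrite nth_zip ?szT ?size_conj_part //= nth_conj_part // => /andP[/eqP <- ->].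
  by [].
pose tau (k : 'I_n) : tableau := nth [::] (nth fset0 Ts (colc nu k)) (rowc nu k).
have tauT k : tau k \in nth fset0 Ts (colc nu k).
  by apply: mem_nth; rewrite (Tcss _ (colc_lt_head nu_n k)).1 (rowc_collen nu_n).
have taucss k : conj_semistandard (conj_part mu) (tau k).
  have [_ /allP H] := Tcss _ (colc_lt_head nu_n k).
  exact: H (tauT k).
have taush k : shape (tau k) = conj_part mu by case/and4P: (taucss k) => /eqP.
pose w (i : 'I_(m * n)) := (entry mu (tau (blk i)) (pos i)).-1.
have wE x k : w (mxvec_index x k) = (entry mu (tau k) x).-1 by rewrite /w posE blkE.
have cnt j : #|[pred i | w i == j]| = nth 0 la j.
  rewrite -occ /occurrences (big_nth fset0) big_mkord szT.
  rewrite -sum1_card big_mkcond big_blocks (big_columns _ _ nu_n) /=.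
  apply: eq_bigr => c _; rewrite (big_nth [::]) big_mkord (Tcss c _).1 //.
  apply: (big_column nu_n _ (G := fun i => count_mem j.+1 (flatten (nth [::] (nth fset0 Ts c) i)))).
  move=> k ck; rewrite -ck -/(tau k) (count_entry mu_m) //; apply: eq_bigr => x _.
  rewrite inE wE -{2}(prednK (entry_gt0 mu_m x (taucss k))) eqSS.
  by case: eqP.
have la_mn : is_part_of (m * n) la.
  rewrite /is_part_of pla /=; apply/eqP.
  have wlt i : w i < size la.
    by rewrite -(part_nth_gt0 _ pla) -cnt; apply/card_gt0P; exists i; rewrite inE eqxx.
  rewrite -[RHS]card_ord -sum1_card (partition_big (fun i => Ordinal (wlt i)) xpredT) //=.
  rewrite sumnE (big_nth 0) big_mkord; apply: eq_bigr => j _; rewrite -cnt -sum1_card.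
  by apply: eq_bigl => i.
split=> //; have [t tE] := word_tabloid la_mn cnt; exists t; split=> [k|k l nkl ckl].
  have [c r] := entry_ssyt mu_m (taucss k).
  by split=> x y; rewrite !tE !wE; [apply: c | apply: r].
have [/existsP[x /eqP nx]|] :=
    boolP [exists x, row_of la t (mxvec_index x k) != row_of la t (mxvec_index x l)].
  by exists x.
rewrite negb_exists => /forallP H; case/eqP: nkl; apply: (cell_inj _ ckl).
have /eqP : tau k = tau l.
  apply: (entry_inj mu_m) => // x; have /negbNE/eqP := H x; rewrite !tE !wE.
  by have := entry_gt0 mu_m x (taucss k); have := entry_gt0 mu_m x (taucss l); lia.
rewrite /tau ckl nth_uniq ?fset_uniq //; first by move/eqP.
  by rewrite (Tcss _ (colc_lt_head nu_n l)).1 -ckl (rowc_collen nu_n).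
by rewrite (Tcss _ (colc_lt_head nu_n l)).1 (rowc_collen nu_n).
Qed.

Lemma word_tuple (t : 'S_(m * n)) : is_part_of (m * n) la -> family_word t ->
  exists2 Ts : seq {fset tableau}, css_family_tuple (conj_part mu) (conj_part nu) Ts & weight Ts = la.
Proof.
move=> la_mn [tss tdist]; have pla : is_part la by case/andP: la_mn.
pose tau (k : 'I_n) := tableau_of mu (fun x : 'I_m => row_of la t (mxvec_index x k)).
have taucss k : conj_semistandard (conj_part mu) (tau k) by apply: tableau_of_css.
pose S c := [seq tau k | k <- [seq k : 'I_n <- enum 'I_n | colc nu k == c]].
have Suniq c : uniq (S c).
  rewrite map_inj_in_uniq ?(filter_uniq _ (enum_uniq _)) // => k l.
  rewrite !mem_filter => /andP[/eqP ck _] /andP[/eqP cl _] e.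
  apply/eqP; apply: contraT => nkl; have [|x] := tdist k l nkl; first by rewrite ck cl.
  have := entry_tableau_of mu_m (fun x : 'I_m => row_of la t (mxvec_index x k)) x.
  by rewrite -/(tau k) e entry_tableau_of // => -[<-].
(* Passing to a finite set would remove repetitions; there are none, since blocks in one column of
   [nu] carry distinct tableaux. *)
pose T c : {fset tableau} := seq_fset tt (S c).
have TS c : perm_eq (T c) (S c) by rewrite (perm_trans (seq_fset_perm _ _)) // undup_id.
exists [seq T c | c <- iota 0 (head 0 nu)].
  rewrite /css_family_tuple /conj_part all2E !size_map eqxx /= zip_map all_map.
  apply/allP => c; rewrite mem_iota /= => cl; apply/andP; split.
    have := card_column nu_n xpredT c; rewrite count_predT size_iota /collen => <-.
    rewrite (perm_size (TS c)) size_map.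
    by rewrite cardE enumT; apply/eqP; congr size; apply: eq_filter => k; rewrite -[LHS]andbT.
  by rewrite (perm_all _ (TS c)) all_map; apply/allP => k _ /=.
apply/(weightP _ pla) => j.
rewrite -(card_row la_mn t j) /occurrences big_map -[X in iota 0 X]subn0 big_mkord.
rewrite -sum1_card [RHS]big_mkcond big_blocks (big_columns _ _ nu_n) /=.
apply: eq_bigr => c _; rewrite (perm_big _ (TS c)) big_map big_filter big_enum_cond /=.
apply: eq_bigr => k _; rewrite (count_entry mu_m) ?shape_tableau_of //.
apply: eq_bigr => x _; rewrite /entry entry_tableau_of // eqSS inE.
Qed.

End TupleWord.

Import GroupScope GRing.Theory Num.Theory.
Local Open Scope ring_scope.

(** * Specht modules *)

Definition has_hom (F : fieldType) (gT : finGroupType) (G : {group gT})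
    (rU rV : representation F G) : Prop :=
  exists2 A : 'M_(rdegree rU, rdegree rV), A != 0 & forall g, g \in G -> rU g *m A = A *m rV g.

Section Tabloids.

Variables (r : nat) (la : seq nat).
Implicit Types t u g q : 'S_r.

Lemma row_of_mul t g x : row_of la (t * g)%g x = row_of la t (g^-1 x)%g.
Proof. by rewrite /row_of invMg permM. Qed.

Lemma tabloid_eq t u : tabloid la t = tabloid la u <-> row_of la t =1 row_of la u.
Proof.
split=> [e x|e]; last by apply/setP => v; rewrite !inE; apply: eq_forallb => x; rewrite e.
have : t \in tabloid la t by rewrite inE; apply/forallP.
by rewrite e inE => /forallP/(_ x)/eqP.
Qed.

Definition mktab t : tabloids r la :=
  exist (fun A => A \in [set tabloid la t | t : 'S_r]) (tabloid la t)
    (imset_f (tabloid la) (isT : t \in 'S_r)).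

Lemma mktab_ex (X : tabloids r la) : exists t, X = mktab t.
Proof. by case/imsetP: (valP X) => t _ e; exists t; apply: val_inj. Qed.

(** Vectors of the permutation module are handled as functions of a tableau that depend only on its
    tabloid. *)
Definition tabcoord (v : 'rV[rat]_#|tabloids r la|) t : rat := v 0 (enum_rank (mktab t)).

Lemma tabcoord_eq v t u : row_of la t =1 row_of la u -> tabcoord v t = tabcoord v u.
Proof. by move/tabloid_eq => e; rewrite /tabcoord; congr (v 0 (enum_rank _)); apply: val_inj. Qed.

Lemma tabcoord_ext v v' : (forall t, tabcoord v t = tabcoord v' t) -> v = v'.
Proof.
move=> e; apply/rowP => i; have [t tE] := mktab_ex (enum_val i).
by have := e t; rewrite /tabcoord -tE enum_valK.
Qed.

Lemma tabcoord_act v g t : tabcoord (v *m tabloid_repr r la g) t = tabcoord v (t * g^-1)%g.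
Proof.
rewrite /tabcoord mxE (bigD1 (enum_rank (mktab (t * g^-1)%g))) //= [X in _ + X]big1 ?addr0.
  by rewrite mxE !enum_rankK /tabloid_coef /= tabloid_act mulgKV eqxx mulr1.
move=> i ni; rewrite mxE enum_rankK /tabloid_coef; case: eqP => [e|]; last by rewrite mulr0.
case/eqP: ni; apply: (canRL enum_valK); apply: val_inj => /=.
by rewrite -tabloid_act -[tabloid la t]e -rcosetM mulgV rcoset1.
Qed.

Lemma tabcoord_sum (I : finType) (P : pred I) (F : I -> 'rV[rat]_#|tabloids r la|) t :
  tabcoord (\sum_(i | P i) F i) t = \sum_(i | P i) tabcoord (F i) t.
Proof. by rewrite /tabcoord summxE. Qed.

Lemma tabcoordZ a v t : tabcoord (a *: v) t = a * tabcoord v t.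
Proof. by rewrite /tabcoord mxE. Qed.

Definition tabvec t : 'rV[rat]_#|tabloids r la| := delta_mx 0 (enum_rank (mktab t)).

Lemma tabcoord_tabvec t u : tabcoord (tabvec t) u = (tabloid la t == tabloid la u)%:R.
Proof. by rewrite /tabcoord mxE eqxx (inj_eq enum_rank_inj) eq_sym. Qed.

Lemma tabvec_eq t u : row_of la t =1 row_of la u -> tabvec t = tabvec u.
Proof. by move/tabloid_eq => e; apply: tabcoord_ext => v; rewrite !tabcoord_tabvec e. Qed.

Lemma tabvec_act t g : tabvec t *m tabloid_repr r la g = tabvec (t * g)%g.
Proof.
apply: tabcoord_ext => u; rewrite tabcoord_act !tabcoord_tabvec -!tabloid_act; congr (_ (nat_of_bool _)).
by apply/eqP/eqP => [->|<-]; rewrite -rcosetM ?mulgV ?mulVg rcoset1.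
Qed.

Lemma tabvec_span (v : 'rV[rat]_#|tabloids r la|) :
  exists u : 'I_#|tabloids r la| -> 'S_r, v = \sum_i v 0 i *: tabvec (u i).
Proof.
have [u uE] : exists u : 'I_#|tabloids r la| -> 'S_r, forall i, mktab (u i) = enum_val i.
  apply: (fin_all_exists (U := fun=> _) (P := fun i t => mktab t = enum_val i)) => i;
  by have [t ->] := mktab_ex (enum_val i); exists t.
by exists u; rewrite {1}(row_sum_delta v); apply: eq_bigr => i _; rewrite /tabvec uE enum_valK.
Qed.

Lemma polytabloidE t : polytabloid la t = \sum_(q in col_stab la t) (-1) ^+ (q : bool) *: tabvec (t * q)%g.
Proof.
apply: tabcoord_ext => u; rewrite tabcoord_sum; under [RHS]eq_bigr do rewrite tabcoordZ tabcoord_tabvec.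
by rewrite /tabcoord mxE enum_rankK; apply: eq_bigr => q _; rewrite tabloid_act.
Qed.

End Tabloids.

(** Left multiplication by the transposition reverses all signs, so the sum equals its opposite. *)
Lemma sum_sign_tperm r (V : lmodType rat) (K : {set 'S_r}) (x y : 'I_r) (f : 'S_r -> V) :
  x != y -> (forall q, ((tperm x y * q)%g \in K) = (q \in K)) ->
  (forall q, f (tperm x y * q)%g = f q) ->
  \sum_(q in K) (-1) ^+ (q : bool) *: f q = 0.
Proof.
move=> nxy KP fP; set S := (X in X = 0).
have e : S = - S.
  rewrite {1}/S (reindex_inj (mulgI (tperm x y))) /= -sumrN.
  apply: eq_big => [q|q _]; first exact: KP.
  by rewrite fP odd_permM odd_tperm nxy signr_addb mulN1r scaleNr.
apply/eqP; have: S *+ 2 == 0 by rewrite mulr2n {1}e addNr.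
by rewrite -scaler_nat scaler_eq0 pnatr_eq0.
Qed.

(** * Signed column sums *)

Section ColumnAntisymmetrizer.

Variables (r : nat) (la : seq nat).
Local Notation C := (col_stab la (1%g : 'S_r)).

Lemma col_stabM p q : p \in C -> ((p * q)%g \in C) = (q \in C).
Proof.
move=> /col_stab1P pC; apply/col_stab1P/col_stab1P => H x.
  by have := H (p^-1 x)%g; rewrite permM permKV => ->; rewrite -[in RHS](permKV p x) pC.
by rewrite permM H pC.
Qed.

Lemma col_stab_tperm (x y : 'I_r) : colc la x = colc la y -> tperm x y \in C.
Proof. by move=> cxy; apply/col_stab1P => z; case: tpermP => // ->. Qed.

Lemma col_stab1_in : 1%g \in C.
Proof. by apply/col_stab1P => x; rewrite perm1. Qed.

Lemma polytabloid1E : polytabloid la 1%g = \sum_(q in C) (-1) ^+ (q : bool) *: tabvec la q.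
Proof. by rewrite polytabloidE; apply: eq_bigr => q _; rewrite mul1g. Qed.

Definition col_anti (V : representation rat [set: 'S_r]) (v : 'rV_(rdegree V)) :=
  \sum_(q in C) (-1) ^+ (q : bool) *: (v *m V q).

Lemma polytabloid_col q : q \in C -> polytabloid la q = (-1) ^+ (q : bool) *: polytabloid la 1%g.
Proof.
move=> qC; rewrite -[in LHS](mul1g q) -polytabloid_act polytabloid1E mulmx_suml scaler_sumr.
rewrite [RHS](reindex_inj (mulIg q)) /=; apply: eq_big => [p|p pC].
  apply/idP/idP => pC; first by rewrite col_stabM.
  have -> : p = (p * q * q^-1)%g by rewrite mulgK.
  by rewrite col_stabM // -(col_stabM _ qC) mulgV col_stab1_in.
rewrite -scalemxAl tabvec_act scalerA; congr (_ *: _).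
by rewrite odd_permM signr_addb mulrCA -signr_addb addbb mulr1.
Qed.

Definition tabrep mu : representation rat [set: 'S_r] := Representation (tabloid_repr r mu).

Lemma col_anti_tabvec_eq0 mu (u : 'S_r) (x y : 'I_r) : x != y -> colc la x = colc la y ->
  row_of mu u x = row_of mu u y -> col_anti (V := tabrep mu) (tabvec mu u) = 0.
Proof.
move=> nxy cxy rxy; apply: (sum_sign_tperm nxy) => q.
  by rewrite col_stabM // col_stab_tperm.
rewrite /= !tabvec_act; apply: tabvec_eq => z; rewrite mulgA !row_of_mul tpermV.
by case: tpermP => // ->.
Qed.

Lemma col_antiD V (I : finType) (c : I -> rat) (v : I -> 'rV_(rdegree V)) :
  col_anti (\sum_i c i *: v i) = \sum_i c i *: col_anti (v i).
Proof.
rewrite /col_anti; under [RHS]eq_bigr do rewrite scaler_sumr.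
rewrite exchange_big /=; apply: eq_bigr => q _; rewrite mulmx_suml scaler_sumr.
by apply: eq_bigr => i _; rewrite -scalemxAl !scalerA mulrC.
Qed.

Hypothesis la_r : is_part_of r la.

(** Some tabloid in the expansion of [v] survives the signed sum, so its word has no repeated letter
    in a column of [la], and [col_distinct_dominates] applies. *)
Lemma col_anti_neq0 mu (v : 'rV_(rdegree (tabrep mu))) : is_part_of r mu ->
  col_anti v != 0 -> dominates la mu.
Proof.
move=> mu_r; have [u ->] := tabvec_span v; rewrite col_antiD => nz.
have [i nzi] : exists i, col_anti (V := tabrep mu) (tabvec mu (u i)) != 0.
  apply/existsP; apply: contraR nz => /existsPn nz; apply/eqP; apply: big1 => i _.
  by move/negbNE/eqP: (nz i) => ->; rewrite scaler0.
apply: (col_distinct_dominates la_r mu_r (u := u i)) => x y cxy wxy; apply/eqP.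
by apply: contraNT nzi => nxy; apply/eqP; apply: (col_anti_tabvec_eq0 nxy).
Qed.

(** A tabloid that survives is the tabloid of some [q] in the column stabiliser, by
    [col_distinct_factor]; its signed sum is then the polytabloid up to the sign of [q]. *)
Lemma col_anti_tabvec (u : 'S_r) :
  exists c : rat, col_anti (V := tabrep la) (tabvec la u) = c *: polytabloid la 1%g.
Proof.
have [->|nz] := eqVneq (col_anti (V := tabrep la) (tabvec la u)) 0.
  by exists 0; rewrite scale0r.
have uinj (x y : 'I_r) : colc la x = colc la y -> row_of la u x = row_of la u y -> x = y.
  move=> cxy wxy; apply/eqP; apply: contraNT nz => nxy; apply/eqP.
  exact: (col_anti_tabvec_eq0 nxy).
have [q qC uq] := col_distinct_factor la_r la_r uinj erefl.
exists ((-1) ^+ (q : bool)); rewrite (tabvec_eq uq) polytabloid1E scaler_sumr.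
rewrite [RHS](reindex_inj (mulgI q)) /=; apply: eq_big => [p|p pC]; first by rewrite col_stabM.
by rewrite tabvec_act scalerA odd_permM signr_addb mulrA -signr_addb addbb mul1r.
Qed.

Lemma col_anti_tabrep (v : 'rV_(rdegree (tabrep la))) :
  exists c : rat, col_anti v = c *: polytabloid la 1%g.
Proof.
have [u ->] := tabvec_span v; rewrite col_antiD.
have [c cE] := fin_all_exists (U := fun=> rat) (fun i => col_anti_tabvec (u i)).
exists (\sum_i v 0 i * c i); rewrite scaler_suml; apply: eq_bigr => i _.
by rewrite cE scalerA.
Qed.

(** The right side is the inner product of [v] with the polytabloid of [1%g]; the column stabiliser
    is closed under inversion, which keeps signs. *)
Lemma tabcoord_col_anti (v : 'rV_(rdegree (tabrep la))) :
  tabcoord (col_anti v) 1%g = \sum_(q in C) (-1) ^+ (q : bool) * tabcoord v q.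
Proof.
rewrite tabcoord_sum [RHS](reindex_inj invg_inj) /=; apply: eq_big => [q|q _].
  apply/idP/idP => qC; last by rewrite -(col_stabM _ qC) mulVg col_stab1_in.
  by rewrite -(col_stabM _ qC) mulgV col_stab1_in.
by rewrite tabcoordZ tabcoord_act mul1g odd_permV.
Qed.

End ColumnAntisymmetrizer.

(** * Homomorphisms out of Specht modules *)

Section SpechtCoordinates.

Variables (r : nat) (la : seq nat).
Local Notation C := (col_stab la (1%g : 'S_r)).
Local Notation S := (specht r la).

Definition spoly (t : 'S_r) : 'rV_(rdegree S) := in_submod (specht_mx r la) (polytabloid la t).

Lemma polytabloid_sub (t : 'S_r) : (polytabloid la t <= specht_mx r la)%MS.
Proof. by apply: (sumsmx_sup t); rewrite ?genmxE. Qed.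

Lemma spolyK t : val_submod (spoly t) = polytabloid la t.
Proof. exact/in_submodK/polytabloid_sub. Qed.

Lemma spoly_act t g : spoly t *m S g = spoly (t * g)%g.
Proof.
rewrite /spoly -polytabloid_act; symmetry.
by apply: (in_submodJ (specht_module r la)); apply: polytabloid_sub.
Qed.

Lemma spoly_span (x : 'rV_(rdegree S)) : exists c : 'S_r -> rat, x = \sum_t c t *: spoly t.
Proof.
have /sub_sumsmxP[a aE] := val_submodP x.
have [c cE] : exists c : 'S_r -> rat, forall t, a t *m <<polytabloid la t>>%MS = c t *: polytabloid la t.
  apply: (fin_all_exists (U := fun=> rat)
    (P := fun t d => a t *m <<polytabloid la t>>%MS = d *: polytabloid la t)) => t.
  have : (a t *m <<polytabloid la t>> <= polytabloid la t)%MS.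
    by apply: submx_trans (submxMl _ _) _; rewrite genmxE.
  by move/sub_rVP.
exists c; apply: (@val_submod_inj _ _ (specht_mx r la)); rewrite aE linear_sum; apply: eq_bigr => t _.
by rewrite cE linearZ /= spolyK.
Qed.

Lemma spoly_col q : q \in C -> spoly q = (-1) ^+ (q : bool) *: spoly 1%g.
Proof. by move=> qC; rewrite /spoly polytabloid_col // linearZ. Qed.

Lemma spoly_gen (V : representation rat [set: 'S_r]) (A : 'M_(rdegree S, rdegree V)) :
  (forall g, S g *m A = A *m V g) -> spoly 1%g *m A = 0 -> A = 0.
Proof.
move=> hA e0; apply/row_matrixP => i; rewrite row0 rowE.
have [c ->] := spoly_span (delta_mx 0 i); rewrite mulmx_suml big1 // => t _.
by rewrite -scalemxAl -[t]mul1g -spoly_act -mulmxA hA mulmxA e0 mul0mx scaler0.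
Qed.

Lemma card_col_stab_neq0 : #|C|%:R != 0 :> rat.
Proof. by rewrite pnatr_eq0 -lt0n; apply/card_gt0P; exists 1%g; apply: col_stab1_in. Qed.

Lemma col_anti_hom (V : representation rat [set: 'S_r]) (A : 'M_(rdegree S, rdegree V)) :
  (forall g, S g *m A = A *m V g) ->
  forall x, col_anti la x *m A = col_anti la (x *m A).
Proof.
move=> hA x; rewrite mulmx_suml; apply: eq_bigr => q _.
by rewrite -scalemxAl -mulmxA hA mulmxA.
Qed.

Lemma col_anti_spoly : col_anti la (spoly 1%g) = #|C|%:R *: spoly 1%g.
Proof.
rewrite /col_anti (eq_bigr (fun=> spoly 1%g)) => [|q qC].
  by rewrite sumr_const scaler_nat.
by rewrite spoly_act mul1g spoly_col // scalerA -signr_addb addbb scale1r.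
Qed.

Hypothesis la_r : is_part_of r la.

(** The signed column sum multiplies the generator by the order of the column stabiliser, so it does
    not annihilate the nonzero image of the generator. *)
Lemma hom_specht_dominates mu : is_part_of r mu -> has_hom S (tabrep r mu) -> dominates la mu.
Proof.
move=> mu_r [A nzA hA].
have hA' g : S g *m A = A *m tabrep r mu g by apply: hA; rewrite inE.
apply: (@col_anti_neq0 _ _ la_r mu (spoly 1%g *m A)) => //.
rewrite -col_anti_hom // col_anti_spoly -scalemxAl scaler_eq0 negb_or card_col_stab_neq0 /=.
by apply: contraNneq nzA => /(spoly_gen hA') ->.
Qed.

Lemma mul_tabvec_tr (v : 'rV_#|tabloids r la|) u : v *m (tabvec la u)^T = (tabcoord v u)%:M.
Proof.
by rewrite /tabvec trmx_delta -colE; apply/rowP => i; rewrite ord1 !mxE mulr1n.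
Qed.

(** Such a [v] is a combination of polytabloids, hence orthogonal to itself, and a sum of rational
    squares vanishes only trivially. *)
Lemma specht_orth (v : 'rV_#|tabloids r la|) : (v <= specht_mx r la)%MS ->
  (forall t, v *m (polytabloid la t)^T = 0) -> v = 0.
Proof.
move=> vS orth; have [c cE] := spoly_span (in_submod (specht_mx r la) v).
have vE : v = \sum_t c t *: polytabloid la t.
  rewrite -[LHS](in_submodK vS) cE linear_sum; apply: eq_bigr => t _.
  by rewrite linearZ /= spolyK.
have : v *m v^T = 0.
  rewrite {2}vE linear_sum mulmx_sumr big1 // => t _.
  by rewrite linearZ /= -scalemxAr orth scaler0.
move/rowP/(_ 0); rewrite !mxE => /eqP.
rewrite psumr_eq0 => [|i _]; last by rewrite mxE -expr2 sqr_ge0.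
move/allP => z; apply/rowP => i; have := z i (mem_index_enum i).
by rewrite !mxE mulf_eq0 orbb => /eqP.
Qed.

(* James's submodule theorem: either some translate of v is sent by the column
   antisymmetriser to a nonzero multiple of a polytabloid, or v is orthogonal to
   all polytabloids. *)
Lemma hom_specht_inj (V : representation rat [set: 'S_r]) (A : 'M_(rdegree S, rdegree V)) :
  A != 0 -> (forall g, S g *m A = A *m V g) -> row_free A.
Proof.
move=> nzA hA; rewrite -kermx_eq0; apply/rowV0P => x /sub_kermxP xA.
apply: (@val_submod_inj _ _ (specht_mx r la)); rewrite linear0.
apply: specht_orth; first exact: val_submodP.
move=> t; set v := val_submod x.
have vtE : v *m (polytabloid la t)^T =
    (tabcoord (col_anti la (V := tabrep r la) (v *m tabrep r la t^-1%g)) 1%g)%:M.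
  rewrite tabcoord_col_anti -[t in LHS]mul1g -polytabloid_act polytabloid1E mulmx_suml linear_sum mulmx_sumr.
  rewrite raddf_sum; apply: eq_bigr => q _; rewrite -scalemxAl tabvec_act linearZ /= -scalemxAr.
  by rewrite mul_tabvec_tr tabcoord_act invgK -scale_scalar_mx.
rewrite vtE; have [c cE] := col_anti_tabrep la_r (v *m tabrep r la t^-1%g).
have [c0|nzc] := eqVneq c 0; first by rewrite cE c0 scale0r /tabcoord mxE raddf0.
(* Here [c] times the generator is the signed column sum of a translate of a kernel element, so [A]
   kills the generator. *)
case/negP: nzA; apply/eqP; apply: (spoly_gen hA); apply/eqP.
have : (c *: spoly 1%g) *m A == 0.
  have -> : c *: spoly 1%g = col_anti la (x *m S t^-1%g).
    apply: (@val_submod_inj _ _ (specht_mx r la)); rewrite linearZ /= spolyK -cE.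
    rewrite linear_sum; apply: eq_bigr => q _; rewrite linearZ /= -mulmxA.
    by rewrite !val_submodJ ?inE // mulmxA.
  by rewrite col_anti_hom // -mulmxA hA mulmxA xA mul0mx /col_anti big1 // => q _; rewrite mul0mx scaler0.
by rewrite -scalemxAl scaler_eq0 (negPf nzc).
Qed.

End SpechtCoordinates.

Section RowColumnCoefficient.

Variables (r : nat) (la : seq nat).
Implicit Types g q : 'S_r.

(** The coefficient of the base tabloid in the [g]-translate of the base polytabloid. It vanishes
    unless [g] is a column permutation followed by a row permutation. *)
Definition rc_coef g : rat := tabcoord (polytabloid la g) 1%g.

Lemma tabloid_eq1 g :
  reflect (forall x : 'I_r, rowc la (g x) = rowc la x) (tabloid la g == tabloid la 1%g).
Proof.
apply: (iffP eqP) => [/tabloid_eq H x|H].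
  by have := H (g x); rewrite /row_of invg1 perm1 permK.
by apply/tabloid_eq => x; rewrite /row_of invg1 perm1 -!/(rowc _ _) -[in RHS](permKV g x) H.
Qed.

Lemma rc_coefE g : rc_coef g =
  \sum_(q in col_stab la (1%g : 'S_r)) (-1) ^+ (q : bool) * (tabloid la (q * g)%g == tabloid la 1%g)%:R.
Proof.
rewrite /rc_coef -[g in LHS]mul1g -polytabloid_act polytabloid1E mulmx_suml tabcoord_sum.
by apply: eq_bigr => q _; rewrite -scalemxAl tabcoordZ tabvec_act tabcoord_tabvec.
Qed.

Lemma rc_coef_neq0 g : rc_coef g != 0 ->
  exists2 q, q \in col_stab la (1%g : 'S_r) & forall x, rowc la ((q * g)%g x) = rowc la x.
Proof.
rewrite rc_coefE => nz.
have [/existsP[q /andP[qC /tabloid_eq1 qg]]|] :=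
    boolP [exists q, (q \in col_stab la (1%g : 'S_r)) && (tabloid la (q * g)%g == tabloid la 1%g)].
  by exists q.
rewrite negb_exists => /forallP z; case/eqP: nz; apply: big1 => q qC.
by have := z q; rewrite qC /= => /negPf ->; rewrite mulr0.
Qed.

(** Only [q = 1] contributes, since a permutation preserving both rows and columns is trivial. *)
Lemma rc_coef_row g : (forall x : 'I_r, rowc la (g x) = rowc la x) -> rc_coef g = 1.
Proof.
move=> gr; rewrite rc_coefE (bigD1 1%g) ?col_stab1_in //= big1 => [|q /andP[/col_stab1P qC nq1]].
  rewrite odd_perm1 mul1g mul1r addr0.
  by have /tabloid_eq1 -> := gr.
case: tabloid_eq1 => [H|]; last by rewrite mulr0.
case/eqP: nq1; apply/permP => x; rewrite perm1; apply: (cell_inj (mu := la)); last exact: qC.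
by have := H x; rewrite permM gr.
Qed.

End RowColumnCoefficient.

Lemma dominates_anti la ka : is_part la -> is_part ka -> dominates la ka -> dominates ka la -> la = ka.
Proof.
move=> pla pka dlk dkl.
have te k : sumn (take k la) = sumn (take k ka) by apply/eqP; rewrite eqn_leq dlk dkl.
have takeS (s : seq nat) k : sumn (take k.+1 s) = (sumn (take k s) + nth 0%N s k)%N.
  case: (ltnP k (size s)) => ks; first by rewrite (take_nth 0%N ks) sumn_rcons.
  by rewrite nth_default // addn0 !take_oversize ?(leqW ks).
have ne k : nth 0%N la k = nth 0%N ka k.
  by apply/(@addnI (sumn (take k la))); rewrite -takeS te takeS te.
apply: (@eq_from_nth _ 0%N) => //; apply/eqP; rewrite eqn_leq; apply/andP; split.
  by rewrite leqNgt -(part_nth_gt0 _ pla) ne part_nth_gt0 // ltnn.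
by rewrite leqNgt -(part_nth_gt0 _ pka) -ne part_nth_gt0 // ltnn.
Qed.

Lemma dominates_trans la ka rho : dominates la ka -> dominates ka rho -> dominates la rho.
Proof. by move=> h1 h2 k; apply: leq_trans (h2 k) (h1 k). Qed.

(** * Characters, completeness of Specht modules and summands *)

Section Characters.

Variable r : nat.
Notation G := [set: 'S_r].
Implicit Types U V : representation rat G.

Definition chi V (g : 'S_r) : rat := \tr (V g).

Lemma chi_conj V g h : chi V (g ^ h)%g = chi V g.
Proof.
rewrite /chi conjgE !repr_mxM ?inE // mxtrace_mulC -mulmxA -!repr_mxM ?inE //.
by rewrite mulgV mulg1.
Qed.

Lemma chiV V g : chi V g^-1%g = chi V g.
Proof. by have [h ->] := conj_inv g; rewrite chi_conj. Qed.

(** Averaging the matrix unit at [(i, j)] gives a homomorphism [B i j], and the sum of the entries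
    [B i j i j] is the product of characters; so some [B i j] is nonzero. *)
Lemma chi_prod_hom U V : \sum_g chi U g * chi V g != 0 -> has_hom U V.
Proof.
move=> nz.
pose B i j := \sum_g U g^-1%g *m delta_mx i j *m V g.
have hB i j h : U h *m B i j = B i j *m V h.
  rewrite mulmx_sumr mulmx_suml (reindex_inj (mulIg h)) /=; apply: eq_bigr => g _.
  by rewrite invMg (repr_mxM V) ?inE // !mulmxA -(repr_mxM U) ?inE // mulKVg.
have [/existsP[i /existsP[j nzB]]|] := boolP [exists i, exists j, B i j != 0].
  by exists (B i j) => // g _; apply: hB.
rewrite negb_exists => /forallP z; case/eqP: nz.
transitivity (\sum_i \sum_j B i j i j); last first.
  rewrite big1 // => i _; rewrite big1 // => j _.
  by have := z i; rewrite negb_exists => /forallP/(_ j)/negbNE/eqP ->; rewrite mxE.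
under [RHS]eq_bigr do under eq_bigr do rewrite summxE.
under [RHS]eq_bigr do rewrite exchange_big /=.
rewrite exchange_big /=; apply: eq_bigr => g _; rewrite -chiV /chi mulr_suml.
apply: eq_bigr => i _; rewrite mulr_sumr; apply: eq_bigr => j _.
rewrite !mxE (bigD1 j) //= [X in _ + X]big1 ?addr0 => [|k nkj].
  rewrite !mxE (bigD1 i) //= [X in _ + X]big1 ?addr0 => [|k nki].
    by rewrite mxE !eqxx mulr1.
  by rewrite mxE (negPf nki) mulr0.
rewrite !mxE big1 ?mul0r // => a _; by rewrite mxE (negPf nkj) andbF mulr0.
Qed.

Lemma chi_norm_gt0 V : (0 < rdegree V)%N -> 0 < \sum_g chi V g * chi V g.
Proof.
move=> dV; rewrite (bigD1 1%g) //= ltr_wpDr //.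
  by apply: sumr_ge0 => g _; rewrite -expr2 sqr_ge0.
by rewrite /chi repr_mx1 mxtrace1 -natrM ltr0n muln_gt0 dV.
Qed.

Lemma has_hom_sub_tabrep V la : has_hom V (specht r la) -> has_hom V (tabrep r la).
Proof.
case=> A nzA hA; exists (val_submod A); first by rewrite val_submod_eq0.
move=> g Gg; rewrite -[RHS](val_submodJ (specht_module r la)) //.
by rewrite /val_submod /= mulmxA hA.
Qed.

Lemma specht_degree_gt0 la : (0 < rdegree (specht r la))%N.
Proof.
rewrite /= lt0n mxrank_eq0; apply/eqP => S0.
have := polytabloid_sub la (1%g : 'S_r); rewrite S0 submx0 => /eqP P0.
have h (x : 'I_r) : rowc la ((1%g : 'S_r) x) = rowc la x by rewrite perm1.
have := rc_coef_row h; rewrite /rc_coef P0 /tabcoord mxE.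
by move/eqP; rewrite eq_sym oner_eq0.
Qed.

Let c (i : 'I_#|classes G|) : 'S_r := repr (enum_val i).

Lemma sum_class_fun (F : 'S_r -> rat) : (forall g h, F (g ^ h)%g = F g) ->
  \sum_g F g = \sum_i #|(enum_val i : {set 'S_r})|%:R * F (c i).
Proof.
move=> FJ; rewrite -(big_enum_val (A := pred_of_set (classes G)) (fun X => #|X|%:R * F (repr X))) /=.
rewrite (partition_big (fun g => g ^: G) (mem (classes G))) /=; last first.
  by move=> g _; apply: mem_classes; rewrite inE.
apply: eq_bigr => X XG; transitivity (\sum_(g in X) F (repr X)); last by rewrite sumr_const mulr_natl.
apply: eq_big => [g|g /eqP <-].
  case/imsetP: XG => h _ ->; apply/eqP/idP => [<-|]; first exact: class_refl.
  by move/class_eqP.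
have /imsetP[h _ ->] := mem_repr g (class_refl G g).
by rewrite FJ.
Qed.

(* The characters of the modules S^(ctype c), for c running over representatives
   of the classes, are orthogonal and nonzero, so their matrix of values is
   square and invertible and no nonzero character is orthogonal to all of them. *)
Lemma specht_complete V : (0 < rdegree V)%N ->
  exists i, \sum_g chi (specht r (ctype (c i))) g * chi V g != 0.
Proof.
move=> dV; apply/existsP; rewrite -[X in is_true X]negbK negb_exists; apply/negP => /forallP z.
pose S i := specht r (ctype (c i)).
pose N i := \sum_g chi (S i) g * chi (S i) g.
pose X := \matrix_(i, j) (#|(enum_val j : {set 'S_r})|%:R * chi (S i) (c j)).
pose Y := \matrix_(j, i) (chi (S i) (c j) / N i).
have XY : X *m Y = 1%:M.
  apply/matrixP => i k; rewrite !mxE.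
  transitivity ((\sum_g chi (S i) g * chi (S k) g) / N k).
    rewrite sum_class_fun; last by move=> g h; rewrite !chi_conj.
    by rewrite mulr_suml; apply: eq_bigr => j _; rewrite !mxE !mulrA.
  have [->|nik] := eqVneq i k.
    by rewrite divff //; apply/lt0r_neq0/chi_norm_gt0/specht_degree_gt0.
  have [->|nz] := eqVneq (\sum_g chi (S i) g * chi (S k) g) 0; first by rewrite mul0r.
  have nz' : \sum_g chi (S k) g * chi (S i) g != 0 by under eq_bigr do rewrite mulrC.
  (* A nonzero product gives homomorphisms in both directions, so the two cycle types dominate each
     other, agree, and belong to a single class. *)
  have pp i' := ctype_part (c i').
  have d1 := hom_specht_dominates (pp i) (pp k) (has_hom_sub_tabrep (chi_prod_hom nz)).
  have d2 := hom_specht_dominates (pp k) (pp i) (has_hom_sub_tabrep (chi_prod_hom nz')).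
  case/negP: nik; apply/eqP/enum_val_inj.
  have /ctype_conj[g cg] : ctype (c i) = ctype (c k).
    by apply: dominates_anti d1 d2; [case/andP: (pp i) | case/andP: (pp k)].
  have cE j : enum_val j = c j ^: G.
    have /imsetP[x _ e] := enum_valP j; rewrite /c e; apply/esym/class_eqP.
    exact: mem_repr (class_refl G x).
  by rewrite !cE cg classGidl ?inE.
pose v := \col_j chi V (c j).
have Xv : X *m v = 0.
  apply/colP => i; rewrite !mxE; have := z i; rewrite negbK => /eqP {2}<-.
  rewrite sum_class_fun; last by move=> g h; rewrite !chi_conj.
  by apply: eq_bigr => j _; rewrite !mxE mulrA.
have v0 : v = 0.
  by have [uX _] := mulmx1_unit XY; rewrite -[v](mulKmx uX) Xv mulmx0.
(* The character value at the identity is the degree, which is positive. *)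
have [j jE] : exists j, c j = 1%g.
  have C1 : 1%g ^: G \in classes G by apply: mem_classes; rewrite inE.
  by exists (enum_rank_in C1 (1%g ^: G)); rewrite /c enum_rankK_in // class1G repr_set1.
have := congr1 (fun w : 'cV_ _ => w j 0) v0; rewrite !mxE jE /chi repr_mx1 mxtrace1 => /eqP.
by rewrite pnatr_eq0 eqn0Ngt dV.
Qed.

Lemma specht_hom_exists V : (0 < rdegree V)%N ->
  exists2 ka, is_part_of r ka & has_hom (specht r ka) V.
Proof.
move/specht_complete => [i /chi_prod_hom hV].
by exists (ctype (c i)); first exact: ctype_part.
Qed.

Lemma rat_pgroup : pgroup.pgroup [pchar rat]^'%R G.
Proof. by rewrite /pgroup.pgroup pcharf'_nat pnatr_eq0 -lt0n cardG_gt0. Qed.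

Lemma inj_hom_summand U V (A : 'M_(rdegree U, rdegree V)) :
  row_free A -> (forall g, U g *m A = A *m V g) -> is_summand U V.
Proof.
move=> fA hA.
have modA : mxmodule V <<A>>%MS.
  by apply/mxmoduleP => g _; rewrite (eqmxMr _ (genmxE A)) genmxE -hA submxMl.
have [W modW defV dxAW] := mx_Maschke_pchar V rat_pgroup modA (submx1 _).
exists (Representation (submod_repr modW)).
apply: mx_rsim_trans (mx_rsim_sym (rsim_submod1 (mxmodule1 V) (eqmx_refl _))) _.
apply: (mx_rsim_dadd (rV := Representation (submod_repr modW)) (modU := modA) (modV := modW)
  (mxmodule1 V) defV dxAW _ (mx_rsim_refl _)).
have AA : (A <= <<A>>)%MS by rewrite genmxE.
apply: mx_rsim_sym; exists (in_submod <<A>>%MS A).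
- by rewrite genmxE; apply/esym/eqP.
- by rewrite /row_free mxrank_in_submod.
- move=> g _; rewrite -[RHS](in_submodJ modA) // -hA /in_submod /= !mulmxA; reflexivity.
Qed.

(** A Maschke complement of the kernel of the homomorphism is nonzero, so it receives a nonzero
    homomorphism from some Specht module. This is injective, which gives the summand, and its
    composite with [B] remains nonzero, which gives dominance. *)
Lemma hom_has_summand V la : is_part_of r la -> has_hom V (tabrep r la) ->
  exists ka, [/\ is_part_of r ka, dominates ka la & is_summand (specht r ka) V].
Proof.
move=> la_r [B nzB hB].
have modK : mxmodule V (kermx B).
  by apply/mxmoduleP => g Gg; apply/sub_kermxP; rewrite -mulmxA hB // mulmxA mulmx_ker mul0mx.
have [W modW defV dxKW] := mx_Maschke_pchar V rat_pgroup modK (submx1 _).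
have dW : (0 < \rank W)%N.
  rewrite lt0n mxrank_eq0; apply: contraNneq nzB => W0.
  have /sub_kermxP : (1%:M <= kermx B)%MS by rewrite -defV W0 addsmx_sub submx_refl sub0mx.
  by rewrite mul1mx => ->.
have [ka ka_r [D nzD hD]] := specht_hom_exists (V := Representation (submod_repr modW)) dW.
pose A := val_submod D.
have hA g : specht r ka g *m A = A *m V g.
  by rewrite -[RHS](val_submodJ modW) ?inE // -hD ?inE // /A /val_submod /= mulmxA.
have nzA : A != 0 by rewrite val_submod_eq0.
exists ka; split=> //; last exact: (inj_hom_summand (hom_specht_inj ka_r nzA hA) hA).
apply: (hom_specht_dominates ka_r la_r); exists (A *m B).
  apply: contraNneq nzA => AB0; rewrite -submx0 -(mxdirect_addsP dxKW) sub_capmx val_submodP andbT.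
  exact/sub_kermxP.
by move=> g Gg; rewrite mulmxA hA -!mulmxA hB.
Qed.

(** The projection onto the summand is followed by the inclusion of the Specht module in the
    permutation module. *)
Lemma summand_has_hom V la : is_summand (specht r la) V -> has_hom V (tabrep r la).
Proof.
case=> rW /= [B dE fB hB]; apply: has_hom_sub_tabrep.
exists (B *m col_mx 1%:M 0).
  have /row_fullP[B' B'B] : row_full B by apply/eqP; exact: etrans (eqP fB) dE.
  apply/eqP => /(congr1 (mulmx B')); rewrite mulmx0 mulmxA B'B mul1mx.
  rewrite -[X in _ = X]col_mx0 => /eq_col_mx[/matrixP e0 _].
  have := e0 (Ordinal (specht_degree_gt0 la)) (Ordinal (specht_degree_gt0 la)).
  by rewrite !mxE eqxx => /eqP; rewrite oner_eq0.
move=> g Gg; rewrite mulmxA hB // -!mulmxA; congr (_ *m _).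
by rewrite mul_block_col !mulmx1 !mulmx0 !addr0 mul_col_mx mul1mx mul0mx.
Qed.

End Characters.

(** * Frobenius reciprocity *)

Section Frobenius.

Variables (F : fieldType) (gT : finGroupType) (G H : {group gT}).
Variables (sHG : H \subset G) (rH : representation F H) (rG : representation F G).

Definition has_hom_on : Prop :=
  exists2 A : 'M_(rdegree rH, rdegree rG), A != 0 & forall h, h \in H -> rH h *m A = A *m rG h.

Local Notation rI := (induced_repr sHG rH).

Let reprG (C : {C : {set gT} | C \in rcosets H G}) :
  (repr (val C) \in G) /\ val C = H :* repr (val C).
Proof.
case: C => C /= /rcosetsP[x Gx ->]; split; last by rewrite rcoset_repr.
have /rcosetP[h Hh ->] := mem_repr_rcoset H x.
by rewrite groupM // (subsetP sHG).
Qed.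

Let H_rcosets : gval H \in rcosets H G.
Proof. by apply/rcosetsP; exists 1%g; rewrite ?group1 // rcoset1. Qed.

Let C1 : {C : {set gT} | C \in rcosets H G} := exist (fun C => C \in rcosets H G) _ H_rcosets.

Lemma row_fmx_mul (T : finType) p (M : T -> T -> F) (B : 'M_(_, p)) x :
  row (enum_rank x) (fmx M *m B) = \sum_y M x y *: row (enum_rank y) B.
Proof.
rewrite row_mul; apply/rowP => j; rewrite !mxE summxE (reindex (fun y => enum_rank y)) /=.
  by apply: eq_bigr => y _; rewrite !mxE !enum_rankK.
exact: onW_bij (enum_rank_bij T).
Qed.

Local Notation cosets := {C : {set gT} | C \in rcosets H G}.

Lemma induced_coef_sum x (C D : cosets) h a (V : lmodType F) (f : coset_basis G rH -> V) :
  x \in G -> h \in H -> (repr (val C) * x = h * repr (val D))%g ->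
  \sum_y induced_coef x (C, a) y *: f y = \sum_d rH h a d *: f (D, d).
Proof.
move=> Gx Hh xE.
transitivity (\sum_E \sum_d induced_coef x (C, a) (E, d) *: f (E, d)).
  by rewrite pair_bigA; apply: eq_bigr => -[].
rewrite (bigD1 D) //= [X in _ + X]big1 ?addr0 => [|E nE].
  by apply: eq_bigr => d _; rewrite /induced_coef /= xE mulgK Hh.
apply: big1 => d _; rewrite /induced_coef /= xE.
case: ifP => [|_]; last by rewrite scale0r.
have [_ eE] := reprG E; have [_ eD] := reprG D.
rewrite -mulgA groupMl // -mem_rcoset => /rcoset_eqP e; case/eqP: nE.
by apply: val_inj; rewrite /= eD e -eE.
Qed.

(** One direction restricts to the coset [H], whose chosen representative is 1 and whose translates
    span the induced module. The other extends [A] by applying [rG (repr C)] after [A] on the coset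
    [C]. *)
Lemma induced_has_hom : has_hom rI rG <-> has_hom_on.
Proof.
split=> [[B nzB hB] | [A nzA hA]].
  pose b y : 'rV_(rdegree rG) := row (enum_rank (y : coset_basis G rH)) B.
  have bE x (C D : cosets) a h :
      x \in G -> h \in H -> (repr (val C) * x = h * repr (val D))%g ->
      b (C, a) *m rG x = \sum_d rH h a d *: b (D, d).
    move=> Gx Hh xE; rewrite /b -row_mul -hB // row_fmx_mul.
    exact: (induced_coef_sum a (fun y => b y) Gx Hh xE).
  pose A : 'M_(rdegree rH, rdegree rG) := \matrix_(a, i) b (C1, a) 0 i.
  have rowA a : row a A = b (C1, a) by apply/rowP => i; rewrite !mxE.
  exists A.
    apply: contraNneq nzB => A0; apply/eqP/row_matrixP => i; rewrite row0.
    have -> : row i B = b (enum_val i) by rewrite /b enum_valK.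
    case: (enum_val i) => C a; have [GC eC] := reprG C.
    have := bE (repr (val C)) C1 C a 1%g GC (group1 H).
    rewrite -rowA A0 row0 mul0mx /= repr_group => /(_ erefl).
    rewrite repr_mx1 (bigD1 a) //= mxE eqxx scale1r big1 ?addr0 => [<- //|d nd].
    by rewrite mxE eq_sym (negPf nd) scale0r.
  move=> h Hh; apply/row_matrixP => a; rewrite !row_mul rowA.
  rewrite (bE h C1 C1 a h) ?(subsetP sHG) //=; last by rewrite repr_group mul1g mulg1.
  by rewrite mulmx_sum_row; apply: eq_bigr => d _; rewrite rowA mxE.
pose B : 'M_(rdegree rI, rdegree rG) :=
  \matrix_(i, j) (row (enum_val i).2 A *m rG (repr (val (enum_val i).1))) 0 j.
have rowB (C : cosets) a : row (enum_rank ((C, a) : coset_basis G rH)) B = row a A *m rG (repr (val C)).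
  by apply/rowP => j; rewrite mxE mxE enum_rankK.
exists B.
  apply: contraNneq nzA => B0; apply/eqP/row_matrixP => a; rewrite row0.
  have := rowB C1 a; rewrite B0 row0 /= repr_group repr_mx1 mulmx1 => <-.
  by [].
move=> x Gx; apply/row_matrixP => i; rewrite -(enum_valK i); case: (enum_val i) => C a.
have [GC eC] := reprG C.
have DP : H :* (repr (val C) * x) \in rcosets H G.
  by apply/rcosetsP; exists (repr (val C) * x)%g; rewrite // groupM.
pose D : cosets := exist (fun A => A \in rcosets H G) _ DP.
have [GD eD] := reprG D.
have Hh : (repr (val C) * x * (repr (val D))^-1)%g \in H.
  by rewrite -mem_rcoset -eD /= rcoset_refl.
have xE : (repr (val C) * x = (repr (val C) * x * (repr (val D))^-1) * repr (val D))%g.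
  by rewrite mulgKV.
rewrite row_fmx_mul (induced_coef_sum a _ Gx Hh xE) row_mul rowB.
under eq_bigr do rewrite rowB scalemxAl.
rewrite -mulmx_suml.
have -> : \sum_d rH (repr (val C) * x * (repr (val D))^-1)%g a d *: row d A =
    row a A *m rG (repr (val C) * x * (repr (val D))^-1)%g.
  by rewrite -row_mul -hA // row_mul mulmx_sum_row; apply: eq_bigr => d _; rewrite mxE.
by rewrite -!mulmxA -!repr_mxM ?groupM ?groupV // mulgKV.
Qed.

End Frobenius.

(** * Homomorphisms from the wreath product module *)

Section Tensors.

Variables (m n : nat) (F : fieldType).
Variables (rW : representation F [set: 'S_m]) (rZ : representation F [set: 'S_n]).
Local Notation d1 := (rdegree rW).
Local Notation d2 := (rdegree rZ).
Local Notation N := (oslash rW rZ).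
Local Notation basis := (oslash_basis rW rZ).

Definition tens (e : 'I_n -> 'rV[F]_d1) (z : 'rV[F]_d2) : 'rV[F]_(rdegree N) :=
  \row_i ((\prod_k e k 0 ((enum_val i : basis).1 k)) * z 0 (enum_val i : basis).2).

Lemma sum_basis (f : 'I_n -> 'I_d1 -> F) (z : 'I_d2 -> F) :
  \sum_(y : basis) (\prod_k f k (y.1 k)) * z y.2 = (\prod_k \sum_i f k i) * \sum_a z a.
Proof.
rewrite bigA_distr_bigA /= big_distrlr /= pair_bigA.
by apply: eq_bigr => -[].
Qed.

Lemma tens_ext e e' z : e =1 e' -> tens e z = tens e' z.
Proof. by move=> E; apply/rowP => i; rewrite !mxE; under eq_bigr do rewrite E. Qed.

Lemma tens_act e z s : s \in wreath m n ->
  tens e z *m N s =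
  tens (fun k => let l := (wr_top s)^-1%g k in e l *m rW (wr_base s l)) (z *m rZ (wr_top s)).
Proof.
move=> Ws; rewrite /tens.
rewrite (mul_row_fmx (fun y : basis => (\prod_k e k 0 (y.1 k)) * z 0 y.2)).
apply/rowP => j; rewrite !mxE; set gb := enum_val j.
rewrite /oslash_coef. under [LHS]eq_bigr => y _ do rewrite mulrACA -big_split /=.
rewrite (sum_basis (fun k i => e k 0 i * rW (wr_base s k) i (gb.1 (wr_top s k)))
  (fun a => z 0 a * rZ (wr_top s) a gb.2)); congr (_ * _).
rewrite [RHS](reindex_inj (@perm_inj _ (wr_top s))) /=.
by apply: eq_bigr => k _; rewrite permK mxE.
Qed.

(** A product functional: [u] is applied to every tensor factor and [v] to the last one, as
    [tens_cotens] shows. *)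
Definition cotens (u : 'cV[F]_d1) (v : 'cV[F]_d2) : 'cV[F]_(rdegree N) :=
  \col_i ((\prod_k u ((enum_val i : basis).1 k) 0) * v (enum_val i : basis).2 0).

Lemma tens_cotens e z u v :
  tens e z *m cotens u v = ((\prod_k (e k *m u) 0 0) * (z *m v) 0 0)%:M.
Proof.
apply/rowP => i; rewrite ord1 !mxE mulr1n.
rewrite (reindex (fun y : basis => enum_rank y)) /=; last exact: onW_bij (enum_rank_bij _).
under eq_bigr => y _ do rewrite !mxE !enum_rankK mulrACA -big_split /=.
rewrite (sum_basis (fun k i => e k 0 i * u i 0) (fun a => z 0 a * v a 0)).
by congr (_ * _); apply: eq_bigr => k _; rewrite mxE.
Qed.

Lemma tens_sum (I J : finType) (c : 'I_n -> I -> F) (e : I -> 'rV[F]_d1) (d : J -> F)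
    (z : J -> 'rV[F]_d2) :
  tens (fun k => \sum_i c k i *: e i) (\sum_j d j *: z j) =
  \sum_(p : {ffun 'I_n -> I} * J)
     ((\prod_k c k (p.1 k)) * d p.2) *: tens (fun k => e (p.1 k)) (z p.2).
Proof.
apply/rowP => i; rewrite !mxE summxE.
under eq_bigr do rewrite summxE.
rewrite bigA_distr_bigA /= summxE big_distrlr /= pair_bigA /=.
apply: eq_bigr => p _; rewrite !mxE mulrACA -big_split /=.
by congr (_ * _); apply: eq_bigr => k _; rewrite mxE.
Qed.

Lemma tens_delta (y : basis) :
  delta_mx 0 (enum_rank y) = tens (fun k => delta_mx 0 (y.1 k)) (delta_mx 0 y.2).
Proof.
apply/rowP => i; rewrite !mxE eqxx /= -[i in LHS]enum_valK (inj_eq enum_rank_inj).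
have -> : (enum_val i == y) = ((enum_val i).1 == y.1) && ((enum_val i).2 == y.2).
  by case: (enum_val i) y => f a [g b]; rewrite xpair_eqE.
case: (enum_val i) => f a /=.
have [->|/eqP nfy] := eqVneq f y.1.
  by rewrite big1 ?mul1r // => k _; rewrite mxE !eqxx.
have [k nk] : exists k, f k != y.1 k.
  apply/existsP; apply: contra_notT nfy; rewrite negb_exists => /forallP H.
  by apply/ffunP => k; apply/eqP/negbNE/H.
by rewrite (bigD1 k) //= mxE (negPf nk) andbF !mul0r.
Qed.

Lemma tens_updZ k0 (e : 'rV[F]_d1) z (I : finType) (P : pred I) (c : I -> F) (x : I -> 'rV[F]_d1) :
  tens (fun k => if k == k0 then \sum_(i | P i) c i *: x i else e) z =
  \sum_(i | P i) c i *: tens (fun k => if k == k0 then x i else e) z.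
Proof.
apply/rowP => j; rewrite !mxE summxE (bigD1 k0) //= eqxx summxE !mulr_suml.
apply: eq_bigr => i _; rewrite !mxE [in RHS](bigD1 k0) //= eqxx !mulrA; congr (_ * _ * _).
by apply: eq_bigr => k /negPf ->.
Qed.

End Tensors.

(** * Garnir relations *)

Section Garnir.

Variables (m : nat) (mu : seq nat).
Hypothesis mu_m : is_part_of m mu.

(** After expansion of the polytabloid, fix a column permutation [q]. The set [Z] has more elements
    than either of its columns has rows, so two of its elements lie in the same row of [q]; their
    transposition makes the signed sum over [s] cancel. *)
Lemma garnir (Z : {set 'I_m}) j :
  {in Z, forall z : 'I_m, colc mu z = j \/ colc mu z = j.+1} -> (collen mu j < #|Z|)%N ->
  \sum_(s | perm_on Z s) (-1) ^+ (s : bool) *: spoly mu s = 0.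
Proof.
move=> Zcol Zcard; have pmu : is_part mu by case/andP: mu_m.
have pig q : q \in col_stab mu (1%g : 'S_m) ->
    exists x y, [/\ x \in Z, y \in Z, x != y & rowc mu (q^-1%g x) = rowc mu (q^-1%g y)].
  move=> /col_stab1P qC.
  have [/existsP[x /andP[xZ /existsP[y /and3P[yZ nxy /eqP e]]]]|] := boolP [exists x, (x \in Z) &&
      [exists y, [&& y \in Z, x != y & rowc mu (q^-1%g x) == rowc mu (q^-1%g y)]]].
    by exists x, y.
  rewrite negb_exists => /forallP H; move: Zcard; rewrite ltnNge => /negP[].
  have := @uniq_leq_size _ [seq rowc mu (q^-1%g x) | x <- enum Z] (iota 0 (collen mu j)).
  rewrite size_map -cardE size_iota; apply.
    rewrite map_inj_in_uniq ?enum_uniq // => x y; rewrite !mem_enum => xZ yZ e.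
    apply/eqP; apply: contraT => nxy; have := H x; rewrite xZ negb_exists => /forallP/(_ y).
    by rewrite yZ nxy e eqxx.
  move=> _ /mapP[x xZ ->]; rewrite mem_iota /= add0n.
  have cq : colc mu (q^-1%g x) = colc mu x by rewrite -[in RHS](permKV q x) qC.
  have := rowc_collen mu_m (q^-1%g x); rewrite cq; rewrite mem_enum in xZ.
  move/leq_trans; apply; case: (Zcol x xZ) => -> //.
  rewrite leqNgt; apply/negP; rewrite ltn_collen // => l.
  by have := ltnn (collen mu j); rewrite ltn_collen // ltnW.
apply: (@val_submod_inj _ _ (specht_mx m mu)); rewrite linear0 linear_sum.
transitivity (\sum_(s | perm_on Z s) \sum_(q in col_stab mu (1%g : 'S_m))
    (-1) ^+ (q : bool) *: ((-1) ^+ (s : bool) *: tabvec mu (q * s)%g)).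
  apply: eq_bigr => s _; rewrite linearZ /= spolyK -[s in polytabloid _ s]mul1g -polytabloid_act.
  rewrite polytabloid1E mulmx_suml scaler_sumr; apply: eq_bigr => q _.
  by rewrite -scalemxAl tabvec_act !scalerA mulrC.
rewrite exchange_big big1 //= => q qC; rewrite -scaler_sumr.
have [x [y [xZ yZ nxy e]]] := pig q qC.
rewrite (eq_bigl (fun s => s \in [set s | perm_on Z s])); last by move=> s; rewrite inE.
have tZ : perm_on Z (tperm x y).
  by apply/subsetP => z; rewrite inE; case: tpermP => [->|->|]; rewrite ?eqxx.
rewrite (sum_sign_tperm nxy) ?scaler0 // => s.
  rewrite !inE; apply/idP/idP => sZ; last exact: perm_onM.
  by rewrite -[s](mulKg (tperm x y)) perm_onM // perm_onV.
apply: tabvec_eq => z; rewrite /row_of !invMg tpermV !permM.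
by case: tpermP => // ->.
Qed.

End Garnir.

(** * From a homomorphism to a word *)

Section Words.

Variables (m n : nat) (mu nu la : seq nat).
Hypotheses (m_gt0 : (0 < m)%N).
Hypotheses (mu_m : is_part_of m mu) (nu_n : is_part_of n nu).

Local Notation S1 := (specht m mu).
Local Notation S2 := (specht n nu).
Local Notation N := (oslash S1 S2).
Local Notation M := (tabrep (m * n) la).

Definition wr_gen : 'rV_(rdegree N) := tens (fun=> spoly mu 1%g) (spoly nu 1%g).

Lemma wr_gen_elt g h : wr_gen *m N (wr_elt g h) = tens (fun k => spoly mu (g (h^-1%g k))) (spoly nu h).
Proof.
rewrite tens_act ?wr_elt_wreath // wr_elt_top // spoly_act mul1g.
by apply: tens_ext => k /=; rewrite spoly_act mul1g wr_elt_base.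
Qed.

Definition gupd k (x : 'rV_(rdegree S1)) : 'rV_(rdegree N) :=
  tens (fun l => if l == k then x else spoly mu 1%g) (spoly nu 1%g).

Lemma wr_gen_block k q : wr_gen *m N (block_perm k q) = gupd k (spoly mu q).
Proof.
rewrite wr_gen_elt; apply: tens_ext => l; rewrite invg1 perm1.
by case: eqP.
Qed.

Lemma gupd1 k : gupd k (spoly mu 1%g) = wr_gen.
Proof. by apply: tens_ext => l; case: eqP. Qed.

Variable A : 'M[rat]_(rdegree N, rdegree M).
Hypothesis nzA : A != 0.
Hypothesis hA : forall s, s \in wreath m n -> N s *m A = A *m M s.

Definition hcoef (t : 'S_(m * n)) : rat := tabcoord (wr_gen *m A) t.

Lemma hcoef_act s t : s \in wreath m n -> tabcoord (wr_gen *m N s *m A) t = hcoef (t * s^-1)%g.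
Proof. by move=> Ws; rewrite -mulmxA hA // mulmxA [LHS]tabcoord_act. Qed.

(** Pure tensors of polytabloids span the module and are translates of [wr_gen], so a nonzero
    homomorphism cannot kill [wr_gen]. *)
Lemma hcoef_neq0 : exists t, hcoef t != 0.
Proof.
apply/existsP; apply: contraR nzA; rewrite negb_exists => /forallP z.
have gA0 : wr_gen *m A = 0.
  by apply: tabcoord_ext => t; rewrite [RHS]mxE; apply/eqP/negbNE/z.
apply/eqP/row_matrixP => i; rewrite row0 rowE -[i]enum_valK tens_delta.
set y := enum_val i.
have [c cE] := fin_all_exists (U := fun=> 'S_m -> rat) (fun k => spoly_span (delta_mx 0 (y.1 k))).
have [d ->] := spoly_span (delta_mx 0 y.2).
rewrite (tens_ext (e' := fun k => \sum_t c k t *: spoly mu t)) // tens_sum mulmx_suml big1 // => -[g h] _ /=.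
rewrite -scalemxAl.
have -> : tens (fun k => spoly mu (g k)) (spoly nu h) = wr_gen *m N (wr_elt (fun k => g (h k)) h).
  by rewrite wr_gen_elt; apply: tens_ext => k; rewrite permKV.
by rewrite -mulmxA hA ?wr_elt_wreath // mulmxA gA0 mul0mx scaler0.
Qed.

Local Notation w t := (fun i : 'I_(m * n) => row_of la t i).

Lemma hcoef_eq t u : (forall x k, row_of la t (mxvec_index x k) = row_of la u (mxvec_index x k)) ->
  hcoef t = hcoef u.
Proof. by move=> e; apply: tabcoord_eq => i; rewrite -(cellK i). Qed.

Lemma hcoef_block_col k q t : q \in col_stab mu (1%g : 'S_m) ->
  hcoef (t * (block_perm k q)^-1)%g = (-1) ^+ (q : bool) * hcoef t.
Proof.
move=> qC; rewrite -hcoef_act ?wr_elt_wreath // wr_gen_block (spoly_col qC).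
have := tens_updZ (rW := S1) k (spoly mu 1%g) (spoly nu 1%g) xpredT
   (fun _ : 'I_1 => (-1) ^+ (q : bool)) (fun _ => spoly mu 1%g).
rewrite !big_ord1 -/(gupd k _) -/(gupd k _) => ->.
by rewrite -scalemxAl [LHS]tabcoordZ -/(gupd k _) gupd1.
Qed.

Lemma hcoef_top_col h t : h \in col_stab nu (1%g : 'S_n) ->
  hcoef (t * (wr_elt (fun=> 1%g : 'S_m) h)^-1)%g = (-1) ^+ (h : bool) * hcoef t.
Proof.
move=> hC; rewrite -hcoef_act ?wr_elt_wreath // wr_gen_elt (spoly_col hC).
rewrite (tens_ext (e' := fun=> spoly mu 1%g)) //.
have -> : tens (rW := S1) (rZ := S2) (fun=> spoly mu 1%g) ((-1) ^+ (h : bool) *: spoly nu 1%g) =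
    (-1) ^+ (h : bool) *: wr_gen.
  by apply/rowP => i; rewrite !mxE mulrCA.
by rewrite -scalemxAl [LHS]tabcoordZ.
Qed.

Lemma hcoef_garnir k (Z : {set 'I_m}) j t :
  {in Z, forall z : 'I_m, colc mu z = j \/ colc mu z = j.+1} -> (collen mu j < #|Z|)%N ->
  \sum_(s | perm_on Z s) (-1) ^+ (s : bool) * hcoef (t * (block_perm k s)^-1)%g = 0.
Proof.
move=> Zcol Zcard.
transitivity (tabcoord (gupd k (\sum_(s | perm_on Z s) (-1) ^+ (s : bool) *: spoly mu s) *m A) t).
  rewrite /gupd tens_updZ mulmx_suml tabcoord_sum; apply: eq_bigr => s _.
  by rewrite -scalemxAl [RHS]tabcoordZ -/(gupd k _) -wr_gen_block hcoef_act ?wr_elt_wreath.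
rewrite (garnir mu_m Zcol Zcard) /gupd.
have := tens_updZ (rW := S1) k (spoly mu 1%g) (spoly nu 1%g) pred0
   (fun _ : 'I_1 => 1) (fun _ => 0).
by rewrite !big_pred0_eq => ->; rewrite mul0mx /tabcoord mxE.
Qed.

Lemma eq_opp_eq0 (a : rat) : a = - a -> a = 0.
Proof. by move=> e; lra. Qed.

(** The transposition of the two letters fixes the word but reverses the sign of the coefficient. *)
Lemma hcoef_same_entry k (x y : 'I_m) t : x != y -> colc mu x = colc mu y ->
  row_of la t (mxvec_index x k) = row_of la t (mxvec_index y k) -> hcoef t = 0.
Proof.
move=> nxy cxy e; apply: eq_opp_eq0.
have := hcoef_block_col k t (col_stab_tperm cxy).
rewrite odd_tperm nxy expr1 mulN1r => <-; apply: hcoef_eq => z l.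
rewrite row_of_mul invgK block_perm_tperm.
by case: tpermP => // ->.
Qed.

Lemma hcoef_same_block (k l : 'I_n) t : k != l -> colc nu k = colc nu l ->
  (forall x, row_of la t (mxvec_index x k) = row_of la t (mxvec_index x l)) -> hcoef t = 0.
Proof.
move=> nkl ckl e; apply: eq_opp_eq0.
have := hcoef_top_col t (col_stab_tperm ckl).
rewrite odd_tperm nkl expr1 mulN1r => <-; apply: hcoef_eq => z i.
rewrite row_of_mul invgK wr_eltE perm1.
by case: tpermP => [->|->|].
Qed.

(* At a row descent between two adjacent columns of a block, the Garnir relation
   provides another word in the support, of larger column potential. *)
Lemma hom_word : exists t : 'S_(m * n), family_word mu nu la t.
Proof.
pose P t := hcoef t != 0.
pose Psi (t : 'S_(m * n)) := (\sum_(i < m * n) colc mu (pos i) * row_of la t i)%N.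
pose Phi (t : 'S_(m * n)) := (\sum_(i < m * n) rowc mu (pos i) * row_of la t i)%N.
have [u Pu] := hcoef_neq0.
have [t0 Pt0 max0] := arg_maxnP (P := P) Psi Pu.
have Q0 : P t0 && (Psi t0 == Psi t0) by rewrite Pt0 eqxx.
have [t /andP[Pt /eqP tE] maxt] := arg_maxnP (P := fun t => P t && (Psi t == Psi t0)) Phi Q0.
have cs k : col_strict mu (fun x => row_of la t (mxvec_index x k)).
  move=> x y cxy rxy; have nxy : x != y by apply: contraTneq rxy => ->; rewrite ltnn.
  rewrite ltnNge leq_eqVlt; apply/negP => /predU1P[e|lt].
    by case/eqP: Pt; apply: (hcoef_same_entry nxy cxy (k := k)).
  pose t' := (t * (block_perm k (tperm x y))^-1)%g.
  have t'E i : row_of la t' i = row_of la t (tperm (mxvec_index x k) (mxvec_index y k) i).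
    by rewrite row_of_mul invgK block_perm_tperm.
  suff /maxt : P t' && (Psi t' == Psi t0).
    rewrite /= leqNgt => /negP; apply; rewrite /Phi.
    under [ltnRHS]eq_bigr do rewrite t'E.
    apply: (swap_gain (u := fun i : 'I_(m * n) => rowc mu (pos i)) (v := fun i => row_of la t i)) => //.
    by rewrite !posE.
  apply/andP; split.
    by rewrite /P hcoef_block_col ?col_stab_tperm // mulf_neq0 // signr_eq0.
  rewrite -tE /Psi (reindex_inj (@perm_inj _ (tperm (mxvec_index x k) (mxvec_index y k)))) /=; apply/eqP.
  apply: eq_bigr => i _; rewrite t'E tpermK; congr (_ * _)%N.
  by case: tpermP => // ->; rewrite !posE.
exists t; split=> [k|k l nkl ckl]; last first.
  have [/existsP[x /eqP nx]|] :=
    boolP [exists x, row_of la t (mxvec_index x k) != row_of la t (mxvec_index x l)].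
    by exists x.
  rewrite negb_exists => /forallP e; case/eqP: Pt; apply: (hcoef_same_block nkl ckl) => x.
  by apply/eqP/negbNE/e.
split=> //; apply: (row_weak_adjacent mu_m) => x y rxy cxy; rewrite leqNgt; apply/negP => lt.
pose W x := row_of la t (mxvec_index x k).
(* Garnir's choice: the column of [x] from [x] downwards and the next column down to [y]. Together
   they have one cell more than the column of [x], and all entries on [X] exceed those on [Y]. *)
pose X := [set z : 'I_m | (colc mu z == colc mu x) && (rowc mu x <= rowc mu z)%N].
pose Y := [set z : 'I_m | (colc mu z == colc mu y) && (rowc mu z <= rowc mu y)%N].
have csk := cs k.
have WX z : z \in X -> (W x <= W z)%N.
  rewrite inE => /andP[/eqP cz]; rewrite leq_eqVlt => /predU1P[e|].
    by rewrite (cell_inj e (esym cz)).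
  by move/csk => /(_ (esym cz))/ltnW.
have WY z : z \in Y -> (W z <= W y)%N.
  rewrite inE => /andP[/eqP cz]; rewrite leq_eqVlt => /predU1P[e|].
    by rewrite (cell_inj e cz).
  by move/csk => /(_ cz)/ltnW.
have Xcol : {in X, forall z : 'I_m, colc mu z = colc mu x}.
  by move=> z; rewrite inE => /andP[/eqP].
have Ycol : {in Y, forall z : 'I_m, colc mu z = (colc mu x).+1}.
  by move=> z; rewrite inE => /andP[/eqP ->].
have XYcol : {in X :|: Y, forall z : 'I_m, colc mu z = colc mu x \/ colc mu z = (colc mu x).+1}.
  by move=> z; rewrite inE => /orP[/Xcol|/Ycol]; [left | right].
have XYlt : {in X & Y, forall z1 z2, (W z2 < W z1)%N}.
  by move=> z1 z2 /WX h1 /WY h2; apply: leq_ltn_trans h2 (leq_trans lt h1).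
have XYdis : [disjoint X & Y].
  by apply/pred0P => z; apply/negP => /= /andP[/Xcol cz /Ycol]; rewrite cz; lia.
have lx := rowc_collen mu_m x; have ly := rowc_collen mu_m y.
have XYcard : (collen mu (colc mu x) < #|X :|: Y|)%N.
  rewrite cardsU (eqP (_ : X :&: Y == set0)) ?setI_eq0 // cards0 subn0.
  rewrite /X /Y !cardsE (card_column mu_m (fun i => (rowc mu x <= i)%N)).
  rewrite (card_column mu_m (fun i => (i <= rowc mu y)%N)).
  have -> : count (fun i => i <= rowc mu y)%N (iota 0 (collen mu (colc mu y))) = (rowc mu y).+1.
    rewrite (eq_count (a2 := fun i => (i < (rowc mu y).+1)%N)) //.
    by rewrite count_ltn_iota; apply/minn_idPl.
  have := count_predC (fun i => (i < rowc mu x)%N) (iota 0 (collen mu (colc mu x))).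
  rewrite count_ltn_iota size_iota.
  rewrite (eq_count (a1 := predC _) (a2 := fun i => (rowc mu x <= i)%N)).
    by rewrite rxy in lx *; lia.
  by move=> i; rewrite /= -leqNgt.
have := hcoef_garnir k t XYcol XYcard.
(* A supported term that moves some cell of [Y] out of [Y] has larger column potential, against the
   choice of [t0]. *)
have [/existsP[s /and3P[sXY nsY Ps]]|] := boolP [exists s : 'S_m,
    [&& perm_on (X :|: Y) s, ~~ (s @: Y \subset Y) & hcoef (t * (block_perm k s)^-1)%g != 0]].
  have := max0 _ Ps; rewrite -tE /= leqNgt => /negP[]; rewrite /Psi !big_blocks.
  rewrite (bigD1 k) //= [ltnRHS](bigD1 k) //= -addSn leq_add //.
    under eq_bigr do rewrite posE.
    under [ltnRHS]eq_bigr do rewrite posE row_of_mul invgK block_permE eqxx.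
    exact: (exchange_gain Xcol Ycol XYlt sXY nsY).
  apply: leq_sum => l nl; apply: leq_sum => z _.
  by rewrite row_of_mul invgK block_permE (negPf nl).
(* In the remaining terms [s] preserves [X] and [Y], so it is a column permutation and its two signs
   cancel. The relation then says that a positive multiple of [hcoef t] is zero. *)
rewrite negb_exists => /forallP H.
rewrite (bigID (fun s : 'S_m => s @: Y \subset Y)) /= [X in _ + X]big1 ?addr0; last first.
  move=> s /andP[sXY nsY]; have := H s; rewrite sXY nsY /= negbK => /eqP ->.
  by rewrite mulr0.
rewrite (eq_bigr (fun=> hcoef t)) => [|s /andP[sXY sY]].
  rewrite sumr_const => /eqP; rewrite -mulr_natl mulf_eq0 pnatr_eq0 (negPf Pt) orbF.
  apply/negP; rewrite -lt0n; apply/card_gt0P; exists 1%g.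
  rewrite unfold_in /= perm_on1 /=; apply/subsetP => z /imsetP[z' z'Y ->].
  by rewrite perm1.
rewrite hcoef_block_col ?mulrA -?signr_addb ?addbb ?mul1r //.
have sYE : s @: Y = Y by apply/eqP; rewrite eqEcard sY (card_imset _ (@perm_inj _ s)) /=.
apply/col_stab1P => z.
have [zY|zY] := boolP (z \in Y).
  by rewrite (Ycol z zY) Ycol // -sYE imset_f.
have [zX|zX] := boolP (z \in X); last by rewrite (out_perm sXY) // inE negb_or zX.
rewrite (Xcol z zX) Xcol //.
have : s z \in X :|: Y by rewrite (perm_closed _ sXY) inE zX.
rewrite inE => /orP[//|szY].
by move: szY; rewrite -{1}sYE (mem_imset _ _ (@perm_inj _ s)) (negPf zY).
Qed.

End Words.

Lemma sum_lt_exists (I : finType) (u v : I -> nat) (i0 : I) :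
  (forall i, u i <= v i)%N -> (u i0 < v i0)%N -> (\sum_i u i < \sum_i v i)%N.
Proof.
move=> uv lt; rewrite (bigD1 i0) //= [ltnRHS](bigD1 i0) //= -addSn leq_add //.
by apply: leq_sum => i _.
Qed.

(** * From a word to a homomorphism *)

Section WordHom.

Variables (m n : nat) (mu nu la : seq nat).
Hypotheses (m_gt0 : (0 < m)%N).
Hypotheses (mu_m : is_part_of m mu) (nu_n : is_part_of n nu).

Local Notation S1 := (specht m mu).
Local Notation S2 := (specht n nu).
Local Notation N := (oslash S1 S2).
Local Notation M := (tabrep (m * n) la).

(* The elements (g, tau) of the wreath product that fix a semistandard word and
   are products of a column part (p, q) and a row part have trivial column part:
   the row potential of W k decreases under p k, but its sum over k does not. *)
Lemma labelled_word_rigid (a : 'I_n -> nat) (W : 'I_n -> 'I_m -> nat) (tau q : 'S_n)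
    (g p : 'I_n -> 'S_m) :
  ssyt nu a -> (forall k, ssyt mu (W k)) -> (forall k l, W k =1 W l -> a k = a l) ->
  (forall k x, W (tau k) (g k x) = W k x) ->
  (forall k, p k \in col_stab mu (1%g : 'S_m)) ->
  (forall k x, rowc mu ((p k * g k)%g x) = rowc mu x) ->
  q \in col_stab nu (1%g : 'S_n) -> (forall k, rowc nu ((q * tau)%g k) = rowc nu k) ->
  (forall k x, rowc mu (g k x) = rowc mu x) /\ (forall k, rowc nu (tau k) = rowc nu k).
Proof.
move=> [acol arow] Wss Wa gE pC pg qC qtau.
have WE k x : W k (p k x) = W (tau k) ((p k * g k)%g x) by rewrite permM gE.
pose V k := (\sum_(x < m) rowc mu x * W k x)%N.
pose V' k := (\sum_(x < m) rowc mu x * W k (p k x))%N.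
have V'E k : V' k = V (tau k).
  rewrite /V' /V [RHS](reindex_inj (@perm_inj _ (p k * g k)%g)) /=.
  by apply: eq_bigr => x _; rewrite WE pg.
have p1 k : (V k <= V' k)%N -> p k = 1%g.
  by move=> le; apply: (col_perm_potential mu_m (Wss k).1 _ le); apply/col_stab1P.
have V'le k : (V' k <= V k)%N.
  rewrite leqNgt; apply/negP => lt; have := p1 k (ltnW lt) => pk.
  by move: lt; rewrite /V' /V pk; under [ltnRHS]eq_bigr do rewrite perm1; rewrite ltnn.
have {}p1 k : p k = 1%g.
  apply: p1; rewrite leqNgt; apply/negP => lt.
  have := sum_lt_exists V'le lt; rewrite [ltnRHS](reindex_inj (@perm_inj _ tau)) /=.
  by under eq_bigr do rewrite V'E; rewrite ltnn.
have gr k x : rowc mu (g k x) = rowc mu x by have := pg k x; rewrite p1 mul1g.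
split=> //.
(* Now [g k] carries the semistandard word of block [k] to that of block [tau k] within rows, so
   these words coincide and have the same label. *)
have atau k : a (tau k) = a k.
  apply/esym/Wa; apply: (row_perm_eq (Wss k).2 (Wss (tau k)).2 (gr k)) => x.
  by rewrite gE.
suff q1 : q = 1%g by move=> k; have := qtau k; rewrite q1 mul1g.
apply: (col_perm_potential nu_n acol); first exact/col_stab1P.
rewrite [leqLHS](reindex_inj (@perm_inj _ (q * tau)%g)) /=.
by apply: leq_sum => k _; rewrite qtau permM atau.
Qed.

(** It takes the coefficient of the base tabloid in each tensor factor, so that its values on
    translates of [wr_gen] are products of [rc_coef]. *)
Definition base_functional : 'cV[rat]_(rdegree N) :=
  cotens (rW := S1) (rZ := S2) (val_submod 1%:M *m (tabvec mu 1%g)^T) (val_submod 1%:M *m (tabvec nu 1%g)^T).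

Lemma rc_coef_functional r ka (g : 'S_r) :
  (spoly ka g *m (val_submod 1%:M *m (tabvec ka 1%g)^T)) 0 0 = rc_coef ka g.
Proof.
by rewrite mulmxA -val_submodE spolyK mul_tabvec_tr mxE mulr1n.
Qed.

Lemma wr_gen_functional s : s \in wreath m n ->
  wr_gen m n mu nu *m N s *m base_functional =
  ((\prod_k rc_coef mu (wr_base s k)) * rc_coef nu (wr_top s))%:M.
Proof.
move=> Ws; rewrite tens_act // tens_cotens; congr (_ * _)%:M.
  rewrite [LHS](reindex_inj (@perm_inj _ (wr_top s))) /=; apply: eq_bigr => k _.
  by rewrite permK spoly_act mul1g rc_coef_functional.
by rewrite spoly_act mul1g rc_coef_functional.
Qed.

(** The rank-one map built from [base_functional] and the tabloid of [t] is averaged over the wreath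
    product. The coefficient at [t] of the image of [wr_gen] is a sum of nonnegative terms, and the
    identity contributes 1. *)
Lemma word_hom_labelled (a : 'I_n -> nat) (t : 'S_(m * n)) :
  ssyt nu a -> (forall k, ssyt mu (fun x => row_of la t (mxvec_index x k))) ->
  (forall k l, (fun x => row_of la t (mxvec_index x k)) =1
    (fun x => row_of la t (mxvec_index x l)) -> a k = a l) ->
  has_hom_on (H := wreath_group m n) N M.
Proof.
move=> ass Wss Wa.
pose A := \sum_(s in wreath m n) N s *m (base_functional *m tabvec la t) *m M s^-1%g.
exists A; last first.
  move=> h Wh; rewrite /A mulmx_sumr mulmx_suml.
  rewrite [RHS](reindex_inj (mulgI h)); apply: eq_big => [s|s Ws].
    by rewrite -!/(_ \in wreath_group m n) groupMl.
  cbv beta; rewrite invMg (repr_mxM N Wh Ws) (repr_mxM M) ?inE // !mulmxA.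
  by rewrite -[RHS]mulmxA -(repr_mxM M) ?inE // mulVg repr_mx1 mulmx1.
apply/eqP => A0.
have : tabcoord (wr_gen m n mu nu *m A) t = 0 by rewrite A0 mulmx0 /tabcoord mxE.
rewrite /A mulmx_sumr tabcoord_sum.
have termE s : s \in wreath m n ->
    tabcoord (wr_gen m n mu nu *m (N s *m (base_functional *m tabvec la t) *m M s^-1%g)) t =
    (\prod_k rc_coef mu (wr_base s k)) * rc_coef nu (wr_top s) * (tabloid la (t * s^-1)%g == tabloid la t)%:R.
  move=> Ws; rewrite !mulmxA wr_gen_functional // mul_scalar_mx -scalemxAl [LHS]tabcoordZ.
  by rewrite tabvec_act tabcoord_tabvec.
(* If the term is nonzero, [s] fixes the word and all its components are products of column and row
   permutations. By [labelled_word_rigid] they preserve rows, so every factor is 1. *)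
have term01 s : s \in wreath m n ->
    0 <= tabcoord (wr_gen m n mu nu *m (N s *m (base_functional *m tabvec la t) *m M s^-1%g)) t.
  move=> Ws; rewrite termE //.
  case: eqP => [/tabloid_eq te|_]; last by rewrite mulr0.
  rewrite mulr1.
  have [->//|] := eqVneq ((\prod_k rc_coef mu (wr_base s k)) * rc_coef nu (wr_top s)) 0.
  rewrite mulf_eq0 negb_or => /andP[/prodf_neq0 nzb nzt].
  have gE k x : row_of la t (mxvec_index (wr_base s k x) (wr_top s k)) = row_of la t (mxvec_index x k).
    by have := te (mxvec_index x k); rewrite row_of_mul invgK wreathE.
  have [q qC qtau] := rc_coef_neq0 nzt.
  have pex k : exists p, p \in col_stab mu (1%g : 'S_m) /\
      forall x, rowc mu ((p * wr_base s k)%g x) = rowc mu x.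
    by have [p pC pg] := rc_coef_neq0 (nzb k isT); exists p.
  have [p pE] := fin_all_exists (U := fun=> 'S_m) pex.
  have [gr taur] := labelled_word_rigid ass Wss Wa gE (fun k => (pE k).1) (fun k => (pE k).2) qC qtau.
  rewrite rc_coef_row // mulr1 prodr_ge0 // => k _.
  by rewrite rc_coef_row // ler01.
move/eqP; rewrite psumr_eq0 // => /allP/(_ 1%g (mem_index_enum _)).
rewrite (group1 (wreath_group m n)) /= termE ?(group1 (wreath_group m n)) // invg1 mulg1 eqxx mulr1.
rewrite wr_top1 rc_coef_row; last by move=> x; rewrite perm1.
rewrite big1 ?mul1r ?oner_eq0 // => k _.
by rewrite wr_base1 rc_coef_row // => x; rewrite perm1.
Qed.

(** Blocks are labelled by the position of their word in a list, so equal labels mean equal words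
    and the labels are distinct in each column of [nu]. By [col_inj_ssyt] a permutation of the
    blocks makes the labels semistandard. *)
Lemma word_hom (t : 'S_(m * n)) :
  family_word mu nu la t -> has_hom_on (H := wreath_group m n) N M.
Proof.
move=> [Wss Wd].
pose V k := [seq row_of la t (mxvec_index x k) | x <- enum 'I_m].
have VP k l : V k = V l -> forall x, row_of la t (mxvec_index x k) = row_of la t (mxvec_index x l).
  by move=> /eq_in_map e x; apply: e; rewrite mem_enum.
pose L := [seq V k | k <- enum 'I_n].
pose a k := index (V k) L.
have aP k l : a k = a l -> V k = V l.
  have VL i : V i \in L by rewrite map_f ?mem_enum.
  by move=> e; rewrite -(nth_index [::] (VL k)) -/(a k) e nth_index.
have ainj : col_inj nu a.
  move=> k l ckl /aP/VP e; apply/eqP; apply: contraT => nkl.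
  by have [x] := Wd k l nkl ckl; rewrite e.
have [p ap] := col_inj_ssyt nu_n ainj.
pose t' := (t * (wr_elt (fun=> 1%g : 'S_m) p)^-1)%g.
have t'E x k : row_of la t' (mxvec_index x k) = row_of la t (mxvec_index x (p k)).
  by rewrite row_of_mul invgK wr_eltE perm1.
apply: (@word_hom_labelled (fun k => a (p k)) t') => // [k|k l e].
  have [c w] := Wss (p k).
  by split=> x y; rewrite !t'E; [apply: c | apply: w].
rewrite /a; congr (index _ _); apply/eq_in_map => x _.
by rewrite -!t'E; apply: e.
Qed.

End WordHom.

(* Comparison of the maximal partitions *)
Local Close Scope ring_scope.

Theorem theorem1p2 (m n : nat) (mu nu : seq nat)
    (m_gt0 : (0 < m)%N) (n_gt0 : (0 < n)%N)
    (mu_m : is_part_of m mu) (nu_n : is_part_of n nu) (la : seq nat) :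
  dom_maximal
    (fun ka => is_part_of (m * n) ka
               /\ is_summand (specht (m * n) ka) (foulkes m n mu nu)) la
  <->
  dom_maximal
    (fun ka => is_part ka
               /\ exists2 Ts : seq {fset tableau},
                    css_family_tuple (conj_part mu) (conj_part nu) Ts
                    & weight Ts = ka) la.
Proof.
set P1 := fun ka => _ /\ is_summand _ _; set P2 := fun ka => _ /\ _.
have P12 ka : P1 ka -> P2 ka.
  case=> ka_mn /summand_has_hom /induced_has_hom[A nzA hA].
  split; first by case/andP: ka_mn.
  have [t tP] := hom_word m_gt0 mu_m nu_n nzA hA.
  exact: word_tuple mu_m nu_n t ka_mn tP.
have P21 ka : P2 ka -> exists2 ka', P1 ka' & dominates ka' ka.
  case=> pka [Ts css wE]; have [ka_mn [t tP]] := tuple_word mu_m nu_n pka css wE.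
  have /(induced_has_hom (subsetT _)) := word_hom mu_m nu_n tP.
  by case/(hom_has_summand ka_mn) => ka' [ka'_mn dom summ]; exists ka'.
have P1part ka : P1 ka -> is_part ka by case=> /andP[].
(* Since [P1] implies [P2] and every partition in [P2] is dominated by one in [P1], both have the
   same maximal elements, by antisymmetry of dominance. *)
split=> [[P1la max]|[P2la max]]; split=> //; first exact: P12.
- move=> ka P2ka dka; have [ka' P1ka' dka'] := P21 ka P2ka.
  have e : ka' = la by apply: max => //; apply: dominates_trans dka' dka.
  by apply: dominates_anti dka _; [case: P2ka | exact: P1part | rewrite -e].
- have [ka P1ka dka] := P21 la P2la.
  by rewrite -(max ka (P12 ka P1ka) dka).
by move=> ka P1ka; apply: max; apply: P12.
Qed.
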